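(* There exists a distribution $F$ (with $0<\int_0^\infty\overline F(y)\,dy<\infty$, so that its integrated tail distribution $F^I$ is defined) such that $F\in\mathcal{DK}^c\setminus\mathcal{OL}$ and $F\notin\mathcal{DK}_1$, thus $F\notin\mathcal{J}$, but $F^I\in(\mathcal{J}\cap\mathcal{DK}^c)\setminus(\mathcal{L}\cup\mathcal{D})$, $F^I\notin\mathcal{DK}_1$, and $F^I$ is not weakly tail equivalent to any distribution in $\mathcal{S}$.
   Context: All distributions $F$ are probability distributions on $\mathbb{R}$ with unbounded support contained in $[0,\infty)$; $\overline F:=1-F$ denotes the tail of the distribution function $F$ (so $\overline F(x)>0$ for all $x$), and $F^{*2}$ the convolution of $F$ with itself. Integrated tail distribution: if $0<\mu:=\int_0^\infty\overline F(y)\,dy<\infty$, then $F^I$ is the distribution on $[0,\infty)$ with tail $\overline{F^I}(x)=\mu^{-1}\int_x^\infty\overline F(y)\,dy$ for $x\ge0$. $\mathcal{J}$ (principle of a single big jump): let $(X_i)_{i\ge1}$ be i.i.d. with distribution $F$, and let $X_{n,k}$ be the $k$-th largest among $X_1,\dots,X_n$. Then $F\in\mathcal{J}$ iff for all $n\ge2$, $$\lim_{K\to\infty}\liminf_{x\to\infty}\mathbb{P}\Big(X_{n,1}>x-K\ \Big|\ \sum_{i=1}^nX_i>x\Big)=1 .$$ $\mathcal{DK}^c$ (strongly heavy-tailed): $F\in\mathcal{DK}^c$ iff $\lim_{x\to\infty}e^{\lambda x}\overline F(x)=\infty$ for all $\lambda>0$. $\mathcal{DK}_1$: $F\in\mathcal{DK}_1$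 iff $\lim_{x\to\infty}x^{\delta}\overline F(x)=\infty$ for some $\delta>0$. $\mathcal{OL}$ (generalized long-tailed): $F\in\mathcal{OL}$ iff $\limsup_{x\to\infty}\overline F(x-t)/\overline F(x)<\infty$ for every $t>0$. $\mathcal{L}$ (long-tailed): $F\in\mathcal{L}$ iff $\lim_{x\to\infty}\overline F(x-t)/\overline F(x)=1$ for every $t>0$. $\mathcal{D}$ (dominatedly varying): $F\in\mathcal{D}$ iff $\limsup_{x\to\infty}\overline F(x/2)/\overline F(x)<\infty$. $\mathcal{S}$ (subexponential): $F\in\mathcal{S}$ iff $\lim_{x\to\infty}\overline{F^{*2}}(x)/\overline F(x)=2$. Two distributions $F$ and $G$ are weakly tail equivalent iff $0<\liminf_{x\to\infty}\overline F(x)/\overline G(x)\le\limsup_{x\to\infty}\overline F(x)/\overline G(x)<\infty$. *)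

(* Defs.v *)
From mathcomp Require Import all_boot all_order all_algebra.
From mathcomp Require Import all_classical all_reals all_analysis.
Set Implicit Arguments.
Unset Strict Implicit.
Unset Printing Implicit Defensive.
Import Order.TTheory GRing.Theory Num.Theory.
Import numFieldNormedType.Exports.
Local Open Scope classical_set_scope.
Local Open Scope ring_scope.

Notation law R := (probability (measurableTypeR R) R).

Section Distributions.
Variable R : realType.
Implicit Types F G : law R.

(* The topological support of a Borel measure on the line. *)
Definition msupport F : set R :=
  [set x | forall U : set R, open U -> U x -> (0 < F U)%E].

Definition nonneg_supported F := msupport F `<=` `[0, +oo[%classic.

Definition unbounded_nonneg F :=
  nonneg_supported F /\ ~ bounded_set (msupport F).

(* Stated for arbitrary set functions so that it also applies to [convolution]. *)
Definition tail (F : set R -> \bar R) (x : R) : R := 1 - fine (F `]-oo, x]%classic).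

Definition convolution F G : set R -> \bar R :=
  pushforward (F \x G)%E (fun z : measurableTypeR R * measurableTypeR R => z.1 + z.2).

Definition mean F : \bar R :=
  (\int[lebesgue_measure]_(y in `[0%R, +oo[) (tail F y)%:E)%E.

(* [G] is F^I; as a law is determined by its tail, there is at most one such
   [G]. It is only meaningful when [0 < mean F < +oo]. *)
Definition integrated_tail F G :=
  nonneg_supported G /\
  forall x : R, 0 <= x ->
    tail G x =
      (fine (mean F))^-1 * \int[lebesgue_measure]_(y in `[x, +oo[) tail F y.

Definition mutually_independent d (T : measurableType d) (P : probability T R)
    n (X : 'I_n -> {RV P >-> R}) :=
  forall (J : {set 'I_n}) (A : 'I_n -> set R), (forall i, measurable (A i)) ->
    P (\bigcap_(i in [set` J]) (X i @^-1` A i)) =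
      (\prod_(i in J) P (X i @^-1` A i))%E.

Definition iid d (T : measurableType d) (P : probability T R)
    n (X : 'I_n -> {RV P >-> R}) F :=
  mutually_independent X /\
  forall i (A : set R), measurable A -> distribution P (X i) A = F A.

Definition cond_prob d (T : measurableType d) (P : probability T R)
    (A B : set T) : R := fine (P (A `&` B)) / fine (P B).

(* The k-th largest entry of [s], counted from k = 1 and with multiplicity. *)
Definition kth_largest (k : nat) (s : seq R) : R := nth 0 (sort >=%O s) k.-1.

Definition limsupy (f : R -> R) : \bar R :=
  limf_esup (fun x => (f x)%:E) +oo%R.
Definition liminfy (f : R -> R) : \bar R :=
  limf_einf (fun x => (f x)%:E) +oo%R.

(* The condition for a given n only involves the joint law of X_1, ..., X_n,
   so it is required of every i.i.d. family of length n. *)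
Definition class_J : set (law R) := [set F : law R |
  forall n, (2 <= n)%N ->
  forall d (T : measurableType d) (P : probability T R)
    (X : 'I_n -> {RV P >-> R}), iid X F ->
  liminfy (fun x => cond_prob P
      [set w | x - K < kth_largest 1 [seq X i w | i : 'I_n]]
      [set w | x < \sum_(i < n) X i w])
    @[K --> +oo] --> 1%E].

Definition class_DKc : set (law R) := [set F : law R |
  forall lambda : R, 0 < lambda ->
    expR (lambda * x) * tail F x @[x --> +oo] --> +oo].

Definition class_DK1 : set (law R) := [set F : law R |
  exists2 delta : R, 0 < delta & x `^ delta * tail F x @[x --> +oo] --> +oo].

Definition class_OL : set (law R) := [set F : law R |
  forall t : R, 0 < t ->
    (limsupy (fun x => tail F (x - t) / tail F x)%R < +oo)%E].

Definition class_L : set (law R) := [set F : law R |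
  forall t : R, 0 < t -> tail F (x - t) / tail F x @[x --> +oo] --> (1 : R)].

Definition class_D : set (law R) := [set F : law R |
  (limsupy (fun x => tail F (x / 2) / tail F x)%R < +oo)%E].

Definition class_S : set (law R) := [set F : law R |
  tail (convolution F F) x / tail F x @[x --> +oo] --> (2 : R)].

Definition weakly_tail_equivalent F G :=
  let q x := tail F x / tail G x in
  [/\ (0 < liminfy q)%E, (liminfy q <= limsupy q)%E & (limsupy q < +oo)%E].

End Distributions.

Arguments class_J : clear implicits.
Arguments class_DKc : clear implicits.
Arguments class_DK1 : clear implicits.
Arguments class_OL : clear implicits.
Arguments class_L : clear implicits.
Arguments class_D : clear implicits.
Arguments class_S : clear implicits.

(* Main.v *)
Require Import Defs.
From HB Require Import structures.
From mathcomp Require Import all_boot all_order all_algebra.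
From mathcomp Require Import all_classical all_reals all_analysis.
From mathcomp Require Import measurable_realfun.
From mathcomp Require Import zify ring lra.

(** The law [F] lives on the dyadic scale. Its tail is constant on each block
[2^n, 2^(n+1)), with the constants chosen so that the integrated tail [g], which
is then linear on each block, is divided by 2^(n+1) across the n-th block:
g(2^n) = 2^-(n(n+1)/2) up to normalisation. Both tails are of lognormal type:
they decay faster than every power and more slowly than every exponential, which
settles membership in DK_1 and in DK^c; and g(2^n) / g(2^(n+1)) is unbounded, so
that the integrated law is not in D.

The constant value of the tail of [F] is divided by at least 2^(n+1) on passing
the single point 2^(n+1), so [F] is not in OL. It is then not in J either,
because J is contained in OL ([class_J_OL]): if the tail at x is negligible
compared with the tail at x - t, then the event that one variable exceeds x - t
and another exceeds K + t is much more likely than a variable above x.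

Integration smooths these jumps without removing them entirely.
- Going back by [t] from 2^(n+1) multiplies [g] by at least 1 + t
  ([integrated_step_law_shift]). For a subexponential law, going back by a fixed
  [t] eventually multiplies the tail by at most 3, whatever [t] is
  ([class_S_tail_shift]), and a weak tail equivalence changes this factor by a
  constant. So no subexponential law is weakly tail equivalent to the
  integrated law, which is not long-tailed for the same reason.
- Going back by [k] from [m], when 2k <= m, multiplies [g] by at most
  (1 + 2k)^2 ([chord_back]). This growth is only polynomial while [g] decays faster than
  every power, so the sum of g(k) g(m - k) over M <= k <= m - M is at most
  eps g(m) once [M] is large, uniformly in [m] ([chord_conv_small]). Such a
  bound gives the principle of a single big jump ([class_J_of_tail]): a sum can
  exceed [x] without any term exceeding x - K only when two groups of terms are
  both large. *)

Set Implicit Arguments.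
Unset Strict Implicit.
Unset Printing Implicit Defensive.
Import Order.TTheory GRing.Theory Num.Theory.
Import numFieldNormedType.Exports.
Local Open Scope classical_set_scope.
Local Open Scope ring_scope.

(** * Limits inferior and superior at infinity *)
Section Limits.
Variable R : realType.
Implicit Types f : R -> R.

Lemma liminfy_ge f (c : R) : (\forall x \near +oo, c <= f x) -> (c%:E <= liminfy f)%E.
Proof.
move=> h; rewrite /liminfy limf_einfE; apply: ereal_sup_ge.
exists (ereal_inf ((fun x => (f x)%:E) @` [set x | c <= f x])); last first.
  by apply: le_ereal_inf_tmp => _ [x /= cx <-]; rewrite lee_fin.
by exists [set x | c <= f x].
Qed.

Lemma liminfy_le f (c : R) : (forall x0, exists2 x, x0 <= x & f x <= c) ->
  (liminfy f <= c%:E)%E.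
Proof.
move=> h; rewrite /liminfy limf_einfE; apply: ge_ereal_sup => _ [V [a [_ hV]] <-].
have [x ax fx] := h (a + 1); apply: ereal_inf_le; exists (f x)%:E; last by rewrite lee_fin.
by exists x => //; apply: hV; apply: lt_le_trans ax; rewrite ltrDl.
Qed.

Lemma liminfy_gt0 f : (0 < liminfy f)%E ->
  exists2 c, 0 < c & \forall x \near +oo, c <= f x.
Proof.
rewrite /liminfy limf_einfE => /ereal_sup_gt[_ [V hV <-]] h.
have [y y0 hy] : exists2 c, 0 < c & (c%:E <= ereal_inf ((fun x => (f x)%:E) @` V))%E.
  case: (ereal_inf _) h => [r| |] //; first by rewrite lte_fin; exists r.
  by exists 1; rewrite // leey.
exists y => //; near=> x.
rewrite -lee_fin; apply: (le_trans hy); apply: ereal_inf_lbound; exists x => //.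
by near: x.
Unshelve. all: by end_near. Qed.

Lemma limsupy_lty f : (limsupy f < +oo)%E -> exists C, \forall x \near +oo, f x <= C.
Proof.
rewrite /limsupy limf_esupE => /ereal_inf_lt[_ [V hV <-]] h.
have [y hy] : exists c : R, (ereal_sup ((fun x => (f x)%:E) @` V) <= c%:E)%E.
  case: (ereal_sup _) h => [r| |] // _; first by exists r.
  by exists 0; rewrite leNye.
exists y; near=> x; rewrite -lee_fin; apply: le_trans hy.
by apply: ereal_sup_ubound; exists x => //; near: x.
Unshelve. all: by end_near. Qed.

Lemma limsupy_unbounded f : (forall B x0, exists2 x, x0 <= x & B <= f x) ->
  ~ (limsupy f < +oo)%E.
Proof.
move=> h /limsupy_lty[C [a [_ ha]]]; have [x ax] := h (C + 1) (a + 1).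
have := ha x (lt_le_trans _ ax); rewrite ltrDl => /(_ ltr01); lra.
Qed.

Lemma not_limsupy_lty f : ~ (limsupy f < +oo)%E ->
  forall B x0, exists2 x, x0 <= x & B <= f x.
Proof.
move=> h B x0; apply: contrapT => h'; apply: h.
rewrite /limsupy limf_esupE; apply: le_lt_trans (ltry B).
apply: ereal_inf_le; exists (ereal_sup ((fun x => (f x)%:E) @` [set x | x0 < x])).
  by exists [set x | x0 < x] => //; exists x0; rewrite num_real.
apply: ge_ereal_sup => _ [x /= xx <-]; rewrite lee_fin leNgt; apply/negP => Bx.
by apply: h'; exists x; exact: ltW.
Qed.

End Limits.

(** * Laws on the line and their tails *)
Section Tails.
Variable R : realType.
Implicit Types F G : law R.

Lemma law_fin F (A : set R) : measurable A -> F A \is a fin_num.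
Proof. by move=> mA; apply: fin_num_measure. Qed.

Lemma law_ray F x : F `]x, +oo[%classic = (tail F x)%:E.
Proof.
rewrite /tail -setCitvl probability_setC // EFinB fineK //; exact: law_fin.
Qed.

Lemma tail_ge0 F x : 0 <= tail F x.
Proof. by rewrite -lee_fin -law_ray. Qed.

Lemma tail_nincr F x y : x <= y -> tail F y <= tail F x.
Proof.
move=> xy; rewrite -lee_fin -!law_ray; apply: le_measure; rewrite ?inE //.
by apply: subset_itvr; rewrite bnd_simp.
Qed.

Lemma law_itv F x y : x <= y -> F `]x, y]%classic = (tail F x - tail F y)%:E.
Proof.
move=> xy; have -> : `]x, y]%classic = `]x, +oo[%classic `\` `]y, +oo[%classic.
  by rewrite setDE setCitvr; apply/seteqP; split=> z /=; rewrite !in_itv /= ?andbT;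
    [move=> /andP[] | move=> [-> ->]].
rewrite measureD // ?ltey_eq ?law_fin // setIidr; last first.
  by apply: subset_itvr; rewrite bnd_simp.
by rewrite EFinB -!law_ray.
Qed.

Lemma measurable_tail F (D : set R) : measurable D -> measurable_fun D (tail F).
Proof. by move=> mD; apply: nonincreasing_measurable => // x y; apply: tail_nincr. Qed.

(** The line has a countable base: an open set that avoids the support is
covered by countably many null intervals with rational endpoints. *)
Lemma law_off_support F (U : set R) : open U -> U `&` msupport F = set0 -> F U = 0%E.
Proof.
move=> oU UF.
pose V n : set R := if @unpickle (rat * rat)%type n is Some q then
  (if pselect (F `]ratr q.1, ratr q.2[%classic = 0%E)
   then `]ratr q.1, ratr q.2[%classic else set0) else set0.
suff : F.-negligible U by move=> /negligibleP; apply; exact: open_measurable.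
have neg : F.-negligible (\bigcup_n V n).
  apply: negligible_bigcup => n; rewrite /V.
  case: unpickle => [q|]; last exact: negligible_set0.
  by case: pselect => q0; [apply/negligibleP | exact: negligible_set0].
apply: negligibleS neg => x Ux; have : ~ msupport F x.
  move=> Fx; have UFx : (U `&` msupport F) x by split.
  by rewrite UF in UFx.
move=> /existsNP[W /not_implyP[oW /not_implyP[Wx /negP]]].
rewrite -leNgt => FW.
have : nbhs x W by rewrite nbhsE /=; exists W.
rewrite -nbhs_ballE => -[e /= e0 eW].
have /rat_in_itvoo[q1] : x - e < x by rewrite gtrBl.
rewrite in_itv /= => /andP[q1l q1r].
have /rat_in_itvoo[q2] : x < x + e by rewrite ltrDl.
rewrite in_itv /= => /andP[q2l q2r].
(* [V] is indexed by codes of pairs of rationals; the code of (q1, q2) is the witness. *)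
exists (pickle (q1, q2)); first exact: I.
rewrite /V pickleK; case: pselect => /=.
  by rewrite in_itv /= q1r q2l.
case; apply/eqP; rewrite eq_le measure_ge0 andbT; apply: le_trans FW.
apply: le_measure; rewrite ?inE //; first exact: open_measurable.
move=> y /=; rewrite in_itv /= => /andP[y1 y2]; apply: eW.
rewrite /ball /= ltr_distlC; apply/andP; split.
  exact: lt_trans q1l y1.
exact: lt_trans y2 q2r.
Qed.

End Tails.

(** * Existence of the integrated tail law *)
Section TailDensity.
Variables (R : realType) (F : law R).

(** The unnormalised integrated tail law: the measure with density [tail F] on
the half-line. *)
Definition tail_density (A : set (measurableTypeR R)) : \bar R :=
  (\int[lebesgue_measure]_(y in A `&` `[0%R, +oo[) (tail F y)%:E)%E.

Let tail_density0 : tail_density set0 = 0%E.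
Proof. by rewrite /tail_density set0I integral_set0. Qed.

Let tail_density_ge0 A : (0 <= tail_density A)%E.
Proof. apply: integral_ge0 => x _. rewrite lee_fin. exact: tail_ge0. Qed.

Let mtail (D : set (measurableTypeR R)) : measurable D ->
  measurable_fun D (fun y => (tail F y)%:E).
Proof. by move=> mD; apply/measurable_EFinP; exact: measurable_tail. Qed.

Let tail_density_sigma_additive : semi_sigma_additive tail_density.
Proof.
move=> /= A mA tA mUA; apply: cvg_toP.
  apply: ereal_nondecreasing_is_cvgn => m n mn.
  by apply: lee_sum_nneg_natr => // k _ _; apply: tail_density_ge0.
rewrite /tail_density setI_bigcupl ge0_integral_bigcup//=.
- by move=> n; apply: measurableI.
- by apply: mtail; rewrite -setI_bigcupl; apply: measurableI.
- by move=> x _; rewrite lee_fin; exact: tail_ge0.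
- exact: trivIset_setIr tA.

Qed.

HB.instance Definition _ := isMeasure.Build _ _ _
  tail_density tail_density0 tail_density_ge0 tail_density_sigma_additive.

Lemma integrated_tail_ex : (0 < mean F < +oo)%E -> exists G, integrated_tail F G.
Proof.
move=> /andP[m0 my].
pose m : {measure set (measurableTypeR R) -> \bar R} := tail_density.
have mE : m setT = mean F by rewrite /m /= /tail_density setTI.
have mfin : mean F \is a fin_num by rewrite ge0_fin_numE // ltW.
pose G : law R := mnormalize m F.
have GE A : G A = (tail_density A * (fine (mean F))^-1%:E)%E.
  by rewrite /G /= /mnormalize mE (gt_eqF m0) (lt_eqF my).
exists G; split.
  move=> x Gx; rewrite /= in_itv /= andbT leNgt; apply/negP => x0.
  have : (0 < G `]-oo, 0%R[%classic)%E.
    by apply: Gx; [exact: interval_open | rewrite /= in_itv].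
  rewrite GE /tail_density (_ : _ `&` _ = set0).
    by rewrite integral_set0 mul0e ltxx.
  apply/seteqP; split=> y //= -[]; rewrite !in_itv /= andbT => y0.
  by rewrite leNgt y0.
move=> x x0; rewrite -[LHS]/(fine (tail G x)%:E) -law_ray GE /tail_density.
rewrite setIidl; last first.
  by apply: subset_itvr; rewrite bnd_simp.
rewrite integral_itv_obnd_cbnd; last exact: mtail.
rewrite fineM //; first by rewrite mulrC.
rewrite ge0_fin_numE; last first.
  by apply: integral_ge0 => y _; rewrite lee_fin; exact: tail_ge0.
apply: le_lt_trans my; apply: ge0_subset_integral => //.
- exact: mtail.
- by move=> y _; rewrite lee_fin; exact: tail_ge0.
- by apply: subset_itvr; rewrite bnd_simp.
Qed.

End TailDensity.

(** * Independent and identically distributed samples *)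
Lemma kth_largest1_gt (R : realType) (a : R) (s : seq R) : s != [::] ->
  (a < kth_largest 1 s) = has (fun y => a < y) s.
Proof.
rewrite /kth_largest /= => s0.
have ss : size (sort >=%O s) = size s by rewrite size_sort.
have st : sorted >=%O (sort >=%O s) by apply: sort_sorted => x y; rewrite le_total.
rewrite -(eq_has_r (mem_sort >=%O s)).
case: (sort _ s) ss st => [/eqP|y t _ /= yt]; first by rewrite eq_sym size_eq0 (negbTE s0).
apply/idP/orP => [->|[//|/hasP[z zt az]]]; first by left.
apply: lt_le_trans az _; have /allP/(_ _ zt) := order_path_min (@ge_trans _ R) yt.
by [].
Qed.

Lemma measure_bigsetU_le d (T : measurableType d) (R : realType)
    (mu : {measure set T -> \bar R}) I (r : seq I) (Q : pred I) (A : I -> set T) :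
  (forall i, measurable (A i)) ->
  (mu (\big[setU/set0]_(i <- r | Q i) A i) <= \sum_(i <- r | Q i) mu (A i))%E.
Proof.
move=> mA; elim: r => [|i r IH]; first by rewrite !big_nil measure0.
rewrite !big_cons; case: (Q i) => //.
apply: le_trans (measureU2 _ _ _) _ => //; first exact: bigsetU_measurable.
exact: leeD2l.
Qed.

Section Independent.
Variables (R : realType) (F : law R).
Context d (T : measurableType d) (P : probability T R) (n : nat)
  (X : 'I_n -> {RV P >-> R}).
Hypothesis iidX : iid X F.

(** For all indices at once, where the factors become values of [F]; every
probability below is estimated through boxes of this kind. *)
Lemma iid_rectangle (A : 'I_n -> set R) : (forall i, measurable (A i)) ->
  P (\bigcap_(i in [set: 'I_n]) (X i @^-1` A i)) = (\prod_(i < n) F (A i))%E.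
Proof.
move=> mA; have [ind eqd] := iidX; have := ind [set: 'I_n]%SET A mA.
have -> : [set` [set: 'I_n]%SET] = [set: 'I_n].
  by apply/seteqP; split => i //= _; rewrite finset.in_setT.
move=> ->; apply: eq_big => [i|i _]; first by rewrite finset.in_setT.
by rewrite -(eqd i) //.
Qed.

Lemma iid_tail i x : P (X i @^-1` `]x, +oo[) = (tail F x)%:E.
Proof. by have [_ eqd] := iidX; rewrite -law_ray -(eqd i). Qed.

Lemma measurable_preX i (A : set R) : measurable A -> measurable (X i @^-1` A).
Proof. by move=> mA; apply: measurable_funPTI. Qed.

Lemma measurable_sum_gt x : measurable [set w | x < \sum_(i < n) X i w].
Proof.
have mS : measurable_fun setT (fun w => \sum_(i < n) X i w).
  by apply: measurable_sum => i.
have := mS measurableT `]x, +oo[%classic (measurable_itv _); rewrite setTI.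
congr measurable; apply/seteqP; split=> w /=; rewrite in_itv /= ?andbT //.
Qed.

Lemma max_gtE x : (0 < n)%N ->
  [set w | x < kth_largest 1 [seq X i w | i : 'I_n]] =
  \big[setU/set0]_(i < n) (X i @^-1` `]x, +oo[).
Proof.
move=> n0; rewrite -bigcup_seq.
have s0 w : [seq X i w | i : 'I_n] != [::] by rewrite -size_eq0 size_map -cardE card_ord -lt0n.
apply/seteqP; split=> w /=.
  rewrite kth_largest1_gt // => /hasP[_ /mapP[i _ ->] xi].
  by exists i; rewrite /= ?mem_index_enum // in_itv /= xi.
move=> [i _]; rewrite /= in_itv /= andbT => xi.
rewrite kth_largest1_gt //; apply/hasP; exists (X i w) => //.
by apply/mapP; exists i; rewrite ?mem_enum.
Qed.

Lemma measurable_max_gt x : (0 < n)%N ->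
  measurable [set w | x < kth_largest 1 [seq X i w | i : 'I_n]].
Proof.
move=> n0; rewrite max_gtE //; apply: bigsetU_measurable => i _.
by apply: measurable_preX.
Qed.

Lemma prob_max_gt x : (0 < n)%N ->
  fine (P [set w | x < kth_largest 1 [seq X i w | i : 'I_n]]) <= n%:R * tail F x.
Proof.
move=> n0; rewrite max_gtE // -lee_fin fineK; last first.
  apply: fin_num_measure; apply: bigsetU_measurable => i _.
  by apply: measurable_preX.
have -> : ((n%:R * tail F x)%:E = \sum_(i < n) P (X i @^-1` `]x, +oo[))%E.
  under eq_bigr do rewrite iid_tail.
  by rewrite sumEFin sumr_const card_ord mulr_natl.
by apply: measure_bigsetU_le => i; apply: measurable_preX.
Qed.
End Independent.

(** The coordinates of the product space form an i.i.d. pair. *)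
Section Pair.
Variables (R : realType) (F : law R).
Let T : measurableType _ := (measurableTypeR R * measurableTypeR R)%type.
Let P : probability T R := (F \x F)%E.
HB.instance Definition _ := isMeasurableFun.Build _ _ T R (fst : T -> R) measurable_fst.
HB.instance Definition _ := isMeasurableFun.Build _ _ T R (snd : T -> R) measurable_snd.
Let coord0 : {RV P >-> R} := (fst : T -> R).
Let coord1 : {RV P >-> R} := (snd : T -> R).
Definition coord (i : 'I_2) : {RV P >-> R} := if val i == 0%N then coord0 else coord1.

Lemma coord_law i (A : set R) : measurable A -> P (coord i @^-1` A) = F A.
Proof.
move=> mA; rewrite /coord; case: (val i == 0%N) => /=.
  have -> : (fst : T -> R) @^-1` A = A `*` setT.
    by apply/seteqP; split=> -[x y] //= [].
  rewrite product_measure1E // -[RHS]mule1; congr (_ * _)%E.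
  exact: probability_setT.
have -> : (snd : T -> R) @^-1` A = setT `*` A.
  by apply/seteqP; split=> -[x y] //= [].
rewrite product_measure1E // -[RHS]mul1e; congr (_ * _)%E.
exact: probability_setT.
Qed.

Lemma iid_coord : iid coord F.
Proof.
split=> [J A mA|i A mA]; last exact: coord_law.
pose B i := if i \in J then A i else setT.
have mB i : measurable (B i) by rewrite /B; case: ifP.
under eq_bigr do rewrite coord_law //.
rewrite big_mkcond /= (eq_bigr (fun i => F (B i))); last first.
  by move=> i _; rewrite /B; case: ifP => // _; rewrite probability_setT.
have -> : \bigcap_(i in [set` J]) (coord i @^-1` A i) =
    B ord0 `*` B (lift ord0 ord0).
  apply/seteqP; split=> [[x y] /= h|[x y] [/= hx hy] i].
    split; rewrite /B; case: ifP => //= iJ; exact: (h _ iJ).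
  rewrite /= => iJ; rewrite /coord; case: eqP => /= i0.
    by have <- : B ord0 = A i; rewrite // /B (_ : ord0 = i) ?iJ //; apply: val_inj.
  have <- : B (lift ord0 ord0) = A i; rewrite // /B (_ : lift _ _ = i) ?iJ //.
  by apply: val_inj; case: i i0 {iJ} => -[|[]].
rewrite product_measure1E; [|exact: mB|exact: mB].
by rewrite !big_ord_recl big_ord0 mule1.
Qed.

End Pair.

Lemma iid_pair_ex (R : realType) (F : law R) :
  exists d (T : measurableType d) (P : probability T R) (X : 'I_2 -> {RV P >-> R}),
    iid X F.
Proof. by do 4!eexists; exact: iid_coord. Qed.

(** * The single big jump principle implies generalized long tails *)
Section JOL.
Variables (R : realType) (F : law R).

(** Suppose that tail (x - t) / tail x is unbounded. Two variables above x - t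
and K + t have a sum above x + K, which happens with probability at least
tail (x - t) * tail (K + t); but the larger one exceeds (x + K) - K = x with
probability at most 2 * tail x, which is negligible in comparison along a
sequence of values of [x]. So the conditional probability has limit inferior
at most 1/2 for every [K]. *)
Lemma class_J_OL : (forall x, 0 < tail F x) -> class_J R F -> class_OL R F.
Proof.
move=> F0 JF t t0; apply: contrapT => /not_limsupy_lty hOL.
have [d [T [P [X iidX]]]] := iid_pair_ex F.
have := JF 2 isT d T P X iidX; set L := fun K => _ => LJ.
have h12 : nbhs 1%E [set y : \bar R | (2^-1%:E < y)%E].
  apply: open_nbhs_nbhs; split; first exact: open_ereal_gt_ereal.
  by rewrite /= lte_fin; lra.
have [a [_ ha]] := LJ _ h12.
have /= := ha (a + 1); rewrite ltrDl => /(_ ltr01); apply/negP; rewrite -leNgt.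
move: (a + 1) => K {a ha h12 LJ}; apply: liminfy_le => x0.
have FK := F0 (K + t).
(* With this ratio, 2 * tail x is at most half of tail (x - t) * tail (K + t). *)
have [x xx hx] := hOL (4 / tail F (K + t)) (x0 - K).
exists (x + K); first by rewrite -lerBlDr.
rewrite addrK /cond_prob.
set A := [set w | x < _]; set B := [set w | _ < \sum_(i < 2) _].
have mA : measurable A by apply: measurable_max_gt.
have mB : measurable B by apply: measurable_sum_gt.
have PA : fine (P (A `&` B)) <= 2 * tail F x.
  apply: le_trans (prob_max_gt iidX x isT); apply: fine_le.
  - by apply: fin_num_measure; apply: measurableI.
  - by apply: fin_num_measure.
  - by apply: le_measure; rewrite ?inE //; apply: measurableI.
have PB : tail F (x - t) * tail F (K + t) <= fine (P B).
  pose C (i : 'I_2) : set R := if val i == 0%N then `]x - t, +oo[%classic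
    else `]K + t, +oo[%classic.
  have mC i : measurable (C i) by rewrite /C; case: ifP.
  have := iid_rectangle iidX mC; rewrite !big_ord_recl big_ord0 mule1 /C /=.
  rewrite !law_ray => PC; rewrite -lee_fin EFinM -PC fineK ?fin_num_measure //.
  apply: le_measure; rewrite ?inE //.
    by apply: fin_bigcap_measurable => // i _; apply: measurable_preX; exact: mC.
  move=> w hw; rewrite /B /= !big_ord_recl big_ord0 addr0.
  have /= := hw ord0 I; have /= := hw (lift ord0 ord0) I.
  by rewrite !in_itv /= !andbT; lra.
have PB0 : 0 < fine (P B) by apply: lt_le_trans PB; rewrite mulr_gt0.
rewrite ler_pdivrMr //; apply: le_trans PA _.
apply: le_trans (ler_wpM2l _ PB); last by rewrite invr_ge0.
move: hx; rewrite ler_pdivrMr // mulrAC ler_pdivlMr //.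
nra.
Qed.

End JOL.

(** * Sums of independent integer variables *)
Fixpoint words (L n : nat) : seq (seq nat) :=
  if n is n'.+1 then [seq k :: w | k <- iota 0 L, w <- words L n'] else [:: [::]].

Lemma mem_words L n w :
  (w \in words L n) = (size w == n) && all (fun k => k < L)%N w.
Proof.
elim: n w => [|n IH] [|k w] //=.
  by apply/allpairsP => -[[a b] []].
apply/allpairsP/idP => [[[a b]] /= [ha hb [-> ->]]|].
  by move: ha hb; rewrite mem_iota IH eqSS => /andP[_ ->] /andP[-> ->].
rewrite eqSS => /and3P[h1 h2 h3]; exists (k, w); split => //=.
  by rewrite mem_iota.
by rewrite IH h1.
Qed.

Section Words.
Variables (R : realFieldType) (g : nat -> R).
Hypothesis g0 : g 0 = 1.
Hypothesis g_nincr : forall k, g k.+1 <= g k.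
Hypothesis g_gt0 : forall k, 0 < g k.

Let p k := g k - g k.+1.

(** The probability that [n] independent integer variables with tail [g], all
smaller than [L], have a sum of at least [m]; [words] enumerates their joint
values. *)
Definition word_sum (L n m : nat) : R :=
  \sum_(w <- words L n | (m <= sumn w)%N) \prod_(k <- w) (g k - g k.+1).

Let p_ge0 k : 0 <= p k. Proof. by rewrite subr_ge0. Qed.
Let p_le k : p k <= g k. Proof. by rewrite gerBl ltW. Qed.
Let g_ge0 k : 0 <= g k. Proof. exact: ltW. Qed.

Lemma word_sumS L n m :
  word_sum L n.+1 m = \sum_(0 <= k < L) p k * word_sum L n (m - k).
Proof.
rewrite /word_sum /= big_mkcond big_allpairs_dep /= /index_iota subn0.
apply: eq_bigr => k _; rewrite -big_mkcond big_distrr /=.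
apply: eq_big => [w|w _]; first by rewrite leq_subLR.
by rewrite big_cons.
Qed.

Lemma word_sum0 L m : word_sum L 0 m = (m == 0)%:R.
Proof.
by rewrite /word_sum /= big_mkcond big_seq1 /= leqn0 big_nil; case: (m == 0).
Qed.

Lemma word_sum_ge0 L n m : 0 <= word_sum L n m.
Proof. by apply: sumr_ge0 => w _; apply: prodr_ge0 => k _; apply: p_ge0. Qed.

Lemma word_sum_nincr L n m m' : (m <= m')%N -> word_sum L n m' <= word_sum L n m.
Proof.
move=> mm; rewrite /word_sum big_mkcond [X in _ <= X]big_mkcond.
apply: ler_sum => w _; case: ifP => [h|_]; first by rewrite (leq_trans mm h).
by case: ifP => // _; apply: prodr_ge0 => k _; apply: p_ge0.
Qed.

Let g_nincr_leq k l : (k <= l)%N -> g l <= g k.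
Proof. exact: (nonincreasing_seqP g).1 g_nincr k l. Qed.

(** Ranges of summation are encoded below as 0-1 factors, so that a sum over
k < L can be bounded termwise by sums over its parts. *)
Let sum_p L a : \sum_(0 <= k < L) (a <= k)%:R * p k <= g a.
Proof.
apply: le_trans (_ : (if (L <= a)%N then 0 else g a - g L) <= _); last first.
  by case: ifP => // _; rewrite gerBl.
elim: L => [|L IH]; first by rewrite big_geq.
rewrite big_nat_recr //=; apply: le_trans (lerD IH (lexx _)) _.
have [La|La] := leqP L.+1 a; first by rewrite (leqNgt a) La mul0r addr0 (ltnW La).
rewrite ltnS in La; rewrite La mul1r /p.
have [aL|aL] := leqP L a; last by lra.
by have -> : a = L by [lia]; lra.
Qed.

Let sum_range L M N (F : nat -> R) : (forall k, 0 <= F k) ->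
  \sum_(0 <= k < L) ((M <= k)%N && (k < N)%N)%:R * F k <= \sum_(M <= k < N) F k.
Proof.
move=> F0; rewrite (big_nat_widenl M 0) // (big_nat_widen _ _ (maxn L N)) ?leq_maxr //.
rewrite (big_nat_widen _ L (maxn L N)) ?leq_maxl //.
rewrite [X in X <= _]big_mkcond [X in _ <= X]big_mkcond;apply: ler_sum => k _ /=.
by case: (k < L)%N; case: (M <= k)%N; case: (k < N)%N;
  rewrite /= ?mul1r ?mul0r.
Qed.

Variable D : R.
Hypothesis g_back1 : forall k, g k <= D * g k.+1.
Hypothesis g_conv : forall eps, 0 < eps -> exists M0 : nat, forall M m, (M0 <= M)%N ->
  \sum_(M <= k < (m - M).+1) g k * g (m - k) <= eps * g m.

Let D_gt0 : 0 < D.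
Proof. by rewrite -(pmulr_lgt0 _ (g_gt0 1)); apply: lt_le_trans (g_back1 0). Qed.

Let D_ge1 : 1 <= D.
Proof.
by rewrite -(ler_pM2r (g_gt0 1)) mul1r; apply: le_trans (g_back1 0).
Qed.

Lemma g_back m j : g (m - j) <= D ^+ j * g m.
Proof.
elim: j => [|j IH]; first by rewrite subn0 mul1r.
apply: le_trans (_ : D * g (m - j) <= _); last first.
  by rewrite exprS -mulrA ler_pM2l.
have [mj|mj] := leqP m j.
  have -> : (m - j.+1 = m - j)%N by lia.
  by rewrite ler_peMl.
by have -> : (m - j = (m - j.+1).+1)%N by lia.
Qed.

(** Induction on [n]: condition on the first variable [k]. If k < M, the others
sum to m - M at least and [g_back] applies; if k > m - M, the first variable
alone has probability at most g (m - M); the middle range is the hypothesis on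
self-convolution. *)
Lemma word_sum_le n : exists C, 0 <= C /\ forall L m, word_sum L n m <= C * g m.
Proof.
elim: n => [|n [C [C0 hC]]].
  exists 1; split=> // L m; rewrite word_sum0 mul1r.
  by case: eqP => [->|_] /=; rewrite ?g0.
have [M hM] := g_conv ltr01.
pose E := D ^+ M; have E0 : 0 <= E by rewrite exprn_ge0 // ltW.
exists (C * E + (C + C * E)); split; first by rewrite !addr_ge0 // mulr_ge0.
move=> L m; rewrite word_sumS.
have gE : g (m - M) <= E * g m by apply: g_back.
apply: le_trans (_ : \sum_(0 <= k < L) ((0 <= k)%:R * p k * (C * E * g m)
   + (((M <= k)%N && (k < (m - M).+1)%N)%:R * (g k * g (m - k)) * C
   + ((m - M).+1 <= k)%:R * p k * C)) <= _).
  apply: ler_sum => k _; rewrite mul1r.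
  have t1 : 0 <= p k * (C * E * g m) by rewrite !mulr_ge0.
  have t2 : 0 <= ((M <= k)%N && (k < (m - M).+1)%N)%:R * (g k * g (m - k)) * C.
    by rewrite !mulr_ge0.
  have t3 : 0 <= ((m - M).+1 <= k)%:R * p k * C by rewrite !mulr_ge0.
  have [kM|Mk] := ltnP k M.
    rewrite /= !mul0r add0r; apply: ler_wpDr => //.
    rewrite ler_wpM2l //; apply: le_trans (hC _ _) _; rewrite -mulrA ler_wpM2l //.
    by apply: le_trans gE; apply: g_nincr_leq; lia.
  apply: ler_wpDl => //; have [km|mk] := ltnP k (m - M).+1.
    rewrite /= !mul0r addr0 mul1r.
    by rewrite -[X in _ <= X]mulrA ler_pM // ?word_sum_ge0 // mulrC hC.
  rewrite /= !mul0r add0r mul1r ler_wpM2l //.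
  apply: le_trans (hC _ _) _; rewrite ler_piMr //.
  by rewrite -g0; apply: g_nincr_leq.
rewrite !big_split /= -!mulr_suml !mulrDl lerD // ?lerD //.
- rewrite -[X in _ <= X]mul1r ler_wpM2r ?mulr_ge0 //; rewrite -[X in _ <= X]g0; exact: (sum_p L 0).
- rewrite mulrC ler_wpM2l //; apply: le_trans (sum_range _ _ _ _) _.
    by move=> k; rewrite mulr_ge0.
  by apply: le_trans (hM _ _ (leqnn _)) _; rewrite mul1r.
- rewrite mulrC -mulrA ler_wpM2l //; apply: le_trans (sum_p _ _) _.
  by apply: le_trans gE; apply: g_nincr_leq.
Qed.

(** The single big jump for integer variables: a sum of at least [m] with all
terms below m - K is rare compared with g m. Condition on the first variable [k]
as before. For k < M the induction hypothesis applies at m - M, with the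
smaller gap K - M; the range k > m - M is empty; and the middle range is
made small by the choice of [M], before [K] is chosen. *)
Lemma word_sum_small n eps : 0 < eps -> exists K0 : nat, forall K m, (K0 <= K)%N ->
  word_sum (m - K) n.+1 m <= eps * g m.
Proof.
elim: n eps => [|n IH] eps e0.
  exists 0%N => K m _; rewrite word_sumS big_nat big1 ?mulr_ge0 ?(ltW e0) //.
  by move=> k /andP[_ kK]; rewrite word_sum0; case: eqP => [|_]; [lia | rewrite mulr0].
have [C [C0 hC]] := word_sum_le n.+1.
have e1 : 0 < eps / 2 / (C + 1) by rewrite !divr_gt0 // ltr_wpDl.
have [M hM] := g_conv e1; pose E := D ^+ M; have E0 : 0 < E by rewrite exprn_gt0.
have e2 : 0 < eps / 2 / E by rewrite !divr_gt0.
have [K1 hK1] := IH _ e2; exists (M + K1)%N => K m hK.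
have [mK|Km] := leqP m K.
  have -> : (m - K = 0)%N by lia.
  by rewrite word_sumS big_geq // mulr_ge0 // ltW.
have gE : g (m - M) <= E * g m by apply: g_back.
rewrite word_sumS; apply: le_trans (_ : \sum_(0 <= k < m - K) ((0 <= k)%:R * p k *
   (eps / 2 * g m) + ((M <= k)%N && (k < (m - M).+1)%N)%:R * (g k * g (m - k)) * C) <= _).
  rewrite !big_nat; apply: ler_sum => k /andP[_ kK]; rewrite mul1r.
  have t1 : 0 <= p k * (eps / 2 * g m) by rewrite mulr_ge0 // mulr_ge0 // ltW // divr_gt0.
  have [kM|Mk] := ltnP k M.
    rewrite mul0r mul0r addr0 ler_wpM2l //.
    apply: le_trans (word_sum_nincr _ _ (_ : m - M <= _)%N) _; first by lia.
    have -> : (m - K = (m - M) - (K - M))%N by lia.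
    apply: le_trans (hK1 _ _ _) _; first by lia.
    apply: le_trans (ler_wpM2l (ltW e2) gE) _.
    by rewrite mulrA divfK // gt_eqF.
  have -> /= : (k < (m - M).+1)%N by lia.
  apply: ler_wpDl => //; rewrite mul1r.
  by rewrite -[X in _ <= X]mulrA ler_pM // ?word_sum_ge0 // mulrC hC.
rewrite big_split /= -!mulr_suml.
have -> : eps * g m = eps / 2 * g m + eps / 2 * g m by rewrite -mulrDl; congr (_ * _); lra.
rewrite lerD //.
  by rewrite -[X in _ <= X]mul1r ler_wpM2r ?mulr_ge0 ?invr_ge0 ?(ltW e0) //;
    rewrite -[X in _ <= X]g0; exact: (sum_p _ 0).
apply: le_trans (ler_wpM2r C0 (le_trans (sum_range _ _ _ _) (hM _ _ (leqnn _)))) _.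
  by move=> k; rewrite mulr_ge0.
rewrite mulrAC ler_wpM2r // -[X in X <= _]mulrA ler_piMr //.
  by rewrite ltW // divr_gt0.
by rewrite mulrC ler_pdivrMr ?ltr_wpDl // mul1r lerDl.
Qed.

End Words.

(** * A criterion for the single big jump principle *)
Section Cells.
Variable R : realType.

(** Unit cells, closed on the right so that their masses are differences of
tails at integers; the first one absorbs the null set of nonpositive numbers. *)
Definition cell (k : nat) : set R :=
  if k is _.+1 then `]k%:R, k.+1%:R]%classic else `]-oo, 1]%classic.

Lemma measurable_cell k : measurable (cell k).
Proof. by case: k => [|k]; exact: measurable_itv. Qed.

Lemma cell_le k y : cell k y -> y <= k.+1%:R.
Proof. by case: k => [|k] /=; rewrite in_itv //= => /andP[]. Qed.

Lemma cell_ex L y : (0 < L)%N -> y <= L%:R -> exists2 k, (k < L)%N & cell k y.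
Proof.
case: L => // L _; elim: L => [|L IH] yL; first by exists 0%N; rewrite //= in_itv.
have [/IH[k kL ky]|Ly] := leP y L.+1%:R; first by exists k => //; apply: leqW.
by exists L.+1; rewrite //= in_itv /= Ly yL.
Qed.

Lemma law_cell (F : law R) k : tail F 0 = 1 ->
  F (cell k) = (tail F k%:R - tail F k.+1%:R)%:E.
Proof.
move=> F0; case: k => [|k]; last by rewrite /cell law_itv // ler_nat.
rewrite /= F0 -[_ `]-oo, 1]%classic]fineK; last exact: law_fin.
by rewrite /tail opprB addrCA subrr addr0.
Qed.

End Cells.
Arguments cell {R} k.

Section Criterion.
Variables (R : realType) (F : law R).
Let g (k : nat) := tail F k%:R.
Hypothesis F0 : tail F 0 = 1.
Hypothesis g_gt0 : forall k, 0 < g k.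
Variable D : R.
Hypothesis g_back1 : forall k, g k <= D * g k.+1.
Hypothesis g_conv : forall eps, 0 < eps -> exists M0 : nat, forall M m, (M0 <= M)%N ->
  \sum_(M <= k < (m - M).+1) g k * g (m - k) <= eps * g m.

Let g0 : g 0 = 1. Proof. exact: F0. Qed.
Let g_nincr k : g k.+1 <= g k. Proof. by apply: tail_nincr; rewrite ler_nat. Qed.
Let D_gt0 : 0 < D.
Proof. by rewrite -(pmulr_lgt0 _ (g_gt0 1)); apply: lt_le_trans (g_back1 0). Qed.

Section Sample.
Context d (T : measurableType d) (P : probability T R) (n : nat)
  (X : 'I_n.+1 -> {RV P >-> R}).
Hypothesis iidX : iid X F.

Let max_gt x := [set w | x < kth_largest 1 [seq X i w | i : 'I_n.+1]].
Let sum_gt x := [set w | x < \sum_(i < n.+1) X i w].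

(** It is enough that the first variable exceeds [x], since the others are almost
surely positive. *)
Lemma tail_le_sum x : tail F x <= fine (P (sum_gt x)).
Proof.
pose C (i : 'I_n.+1) : set R := if i == ord0 then `]x, +oo[%classic
  else `]0, +oo[%classic.
have mC i : measurable (C i) by rewrite /C; case: ifP.
have := iid_rectangle iidX mC; rewrite big_ord_recl big1 ?mule1; last first.
  by move=> i _; rewrite /C /= law_ray F0.
rewrite {2}/C eqxx law_ray => PC; rewrite -lee_fin -PC fineK; last first.
  by apply: fin_num_measure; apply: measurable_sum_gt.
apply: le_measure; rewrite ?inE //; last 1 first.
- move=> w hw; rewrite /sum_gt /= big_ord_recl.
  have /= := hw ord0 I; rewrite /C eqxx /= in_itv /= andbT => xw.
  apply: ltr_wpDr xw; apply: sumr_ge0 => i _.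
  by have /= := hw (lift ord0 i) I; rewrite /C /= in_itv /= andbT => /ltW.
- by apply: fin_bigcap_measurable => // i _; apply: measurable_preX; exact: mC.
- exact: measurable_sum_gt.
Qed.

Let box (w : seq nat) : set T :=
  \bigcap_(i in [set: 'I_n.+1]) (X i @^-1` cell (nth 0%N w i)).

Let measurable_box w : measurable (box w).
Proof.
apply: fin_bigcap_measurable => // i _; apply: measurable_preX.
exact: measurable_cell.
Qed.

Let prob_box w : size w = n.+1 -> P (box w) = (\prod_(k <- w) (g k - g k.+1))%:E.
Proof.
move=> sw; rewrite /box (iid_rectangle iidX); last by move=> i; exact: measurable_cell.
rewrite (big_nth 0%N) sw big_mkord -prodEFin; apply: eq_bigr => i _.
exact: law_cell.
Qed.



(** Rounding each variable to its cell costs at most one unit per variable,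
hence the shift of [y] by n.+1. *)
Lemma prob_sum_no_big_jump_le (L m : nat) x y : (0 < L)%N -> x <= L%:R ->
  (m + n.+1)%N%:R <= y ->
  fine (P (sum_gt y `\` max_gt x)) <= word_sum g L n.+1 m.
Proof.
move=> L0 xL my.
have mE : measurable (sum_gt y `\` max_gt x).
  by apply: measurableD; [apply: measurable_sum_gt | apply: measurable_max_gt].
pose U := \big[setU/set0]_(w <- words L n.+1 | (m <= sumn w)%N) box w.
have mU : measurable U by apply: bigsetU_measurable => w _.
have EU : sum_gt y `\` max_gt x `<=` U.
  move=> w [yS /negP]; rewrite /max_gt /= -leNgt => Mx.
  have Xx i : X i w <= x.
    rewrite leNgt; apply/negP => xX; move: Mx; rewrite leNgt => /negP; apply.
    rewrite kth_largest1_gt; last by rewrite -size_eq0 size_map -cardE card_ord.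
    by apply/hasP; exists (X i w) => //; apply/mapP; exists i; rewrite ?mem_enum.
  have /choice[f hf] : forall i : 'I_n.+1, exists k, (k < L)%N /\ cell k (X i w).
    by move=> i; have [k kL ck] := cell_ex L0 (le_trans (Xx i) xL); exists k.
  pose s := [seq f i | i <- enum 'I_n.+1].
  have ss : size s = n.+1 by rewrite size_map size_enum_ord.
  have sE (i : 'I_n.+1) : nth 0%N s i = f i.
    by rewrite (nth_map ord0) ?size_enum_ord // nth_ord_enum.
  rewrite /U -bigcup_seq_cond; exists s; last first.
    by move=> i _ /=; rewrite sE; exact: (hf i).2.
  apply/andP; split.
    rewrite mem_words ss eqxx /=; apply/allP => k /mapP[i _ ->]; exact: (hf i).1.
  rewrite sumnE big_map big_enum /=.
  have : \sum_(i < n.+1) X i w <= \sum_(i < n.+1) ((f i)%:R + 1).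
    by apply: ler_sum => i _; rewrite natr1; apply: cell_le; exact: (hf i).2.
  move=> /(lt_le_trans yS) /(le_lt_trans my).
  rewrite big_split /= -natr_sum sumr_const card_ord -natrD ltr_nat.
  by rewrite ltn_add2r => /ltnW.
rewrite -lee_fin fineK ?fin_num_measure //.
apply: le_trans (le_measure _ _ _ EU) _; rewrite ?inE //.
apply: le_trans (measure_bigsetU_le _ _ _ _) _ => //.
rewrite /word_sum -sumEFin big_seq_cond [X in (_ <= X)%E]big_seq_cond.
apply: lee_sum => w /andP[]; rewrite mem_words => /andP[/eqP sw _] _.
by rewrite le_eqVlt; apply/orP; left; apply/eqP; exact: prob_box.
Qed.

Lemma cond_prob_max_ge eps : 0 < eps -> exists K0 : R, forall K, K0 <= K ->
  \forall x \near +oo, 1 - eps <= cond_prob P (max_gt (x - K)) (sum_gt x).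
Proof.
move=> e0; pose E := D ^+ n.+2.
have E0 : 0 < E by rewrite exprn_gt0.
have [K0 hK0] := word_sum_small g0 g_nincr g_gt0 g_back1 g_conv n (divr_gt0 e0 E0).
(* With m the integer part of x, the words have letters below m.+1 - K' and
   sum at least m - n.+1, hence a gap of K' - n.+2; and g (m - n.+1) exceeds
   tail x by at most the factor E = D ^+ n.+2. *)
exists (K0 + n.+2)%N%:R => K hK; near=> x.
have K00 : 0 <= K by apply: le_trans hK.
have xK : K <= x by near: x; apply: nbhs_pinfty_ge; rewrite num_real.
have x0 : 0 <= x by apply: le_trans xK.
pose K' := Num.truncn K; pose m := Num.truncn x.
have /andP[K'1 K'2] := truncn_itv K00; have /andP[m1 m2] := truncn_itv x0.
rewrite -/K' in K'1 K'2; rewrite -/m in m1 m2.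
have hK' : (K0 + n.+2 <= K')%N.
  by rewrite -ltnS -(ltr_nat R); apply: le_lt_trans K'2.
have mK' : (K' <= m)%N.
  by rewrite -ltnS -(ltr_nat R); apply: le_lt_trans m2; apply: le_trans xK.
set A := max_gt _; set B := sum_gt _.
have mA : measurable A by apply: measurable_max_gt.
have mB : measurable B by apply: measurable_sum_gt.
have xL : x - K <= ((m - n.+1) - (K' - n.+2))%N%:R.
  have -> : ((m - n.+1) - (K' - n.+2) = m.+1 - K')%N by clear -hK' mK'; lia.
  by rewrite natrB ?leqW // lerB // ltW.
have PD : fine (P (B `\` A)) <= eps * tail F x.
  apply: le_trans (prob_sum_no_big_jump_le (m := m - n.+1) _ xL _) _.
  - by clear -hK' mK'; lia.
  - by rewrite subnK //; clear -hK' mK'; lia.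
  apply: le_trans (hK0 _ _ _) _; first by clear -hK' mK'; lia.
  have := g_back g_nincr g_gt0 g_back1 m.+1 n.+2; rewrite subSS => h.
  apply: le_trans (ler_wpM2l _ h) _; first by rewrite ltW // divr_gt0.
  rewrite mulrA divfK ?gt_eqF // ler_pM2l // /g; apply: tail_nincr; exact: ltW.
have PB := tail_le_sum x; rewrite -/B in PB.
have Px : 0 < tail F x.
  by apply: lt_le_trans (g_gt0 m.+1) _; apply: tail_nincr; exact: ltW.
have PB0 : 0 < fine (P B) by apply: lt_le_trans PB.
rewrite /cond_prob ler_pdivlMr //.
have : fine (P B) = fine (P (A `&` B)) + fine (P (B `\` A)).
  rewrite -fineD ?fin_num_measure //; [|exact: measurableI|exact: measurableD].
  by rewrite setIC addeC -measureDI.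
move=> PE; rewrite mulrBl mul1r lerBlDr {1}PE lerD2l; apply: le_trans PD _.
by rewrite ler_pM2l.
Unshelve. all: by end_near. Qed.

Lemma cond_prob_le1 (A B : set T) : measurable A -> measurable B -> cond_prob P A B <= 1.
Proof.
move=> mA mB; rewrite /cond_prob.
have [->|PB] := eqVneq (fine (P B)) 0; first by rewrite invr0 mulr0.
have PB0 : 0 < fine (P B) by rewrite lt_def PB fine_ge0.
rewrite ler_pdivrMr // mul1r fine_le ?fin_num_measure //; first exact: measurableI.
by apply: le_measure; rewrite ?inE //; apply: measurableI.
Qed.

End Sample.

(** By [cond_prob_max_ge] the limit inferior lies between 1 - eps and 1 once [K]
is large. *)
Lemma class_J_of_tail : class_J R F.
Proof.
move=> [//|n] _ d T P X iidX.
set L := fun K => _.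
have L1 K : (L K <= 1%:E)%E.
  apply: liminfy_le => x0; exists x0 => //; apply: cond_prob_le1.
    exact: measurable_max_gt.
  exact: measurable_sum_gt.
have Le eps : 0 < eps -> \forall K \near +oo, ((1 - eps)%:E <= L K)%E.
  move=> e0; have [K0 hK0] := cond_prob_max_ge iidX e0.
  near=> K; apply: liminfy_ge; apply: hK0.
  by near: K; apply: nbhs_pinfty_ge; rewrite num_real.
have Lfin : \forall K \near +oo, L K \is a fin_num.
  near=> K; rewrite fin_numElt; apply/andP; split.
    apply: lt_le_trans (ltNyr (1 - 1)) _; near: K; exact: Le.
  exact: le_lt_trans (L1 K) (ltry 1).
apply/fine_cvgP; split=> //; apply/cvgrPdist_le => eps e0; near=> K.
have Kf : L K \is a fin_num by near: K.
rewrite ger0_norm; last by rewrite subr_ge0 -lee_fin fineK.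
rewrite lerBlDr -lerBlDl -lee_fin fineK //; near: K; exact: Le.
Unshelve. all: by end_near. Qed.

End Criterion.

(** * Tails of subexponential laws *)
Lemma fine_prob_setC d (T : measurableType d) (R : realType) (P : probability T R)
  (A : set T) : measurable A -> fine (P (~` A)) = 1 - fine (P A).
Proof.
by move=> mA; rewrite probability_setC // fineB // fin_num_measure.
Qed.

Section Subexp.
Variables (R : realType) (G : law R).

Let idR : measurableTypeR R -> R := idfun.
HB.instance Definition _ :=
  @isMeasurableFun.Build _ _ _ _ idR (@measurable_id _ _ setT).

Lemma tail_cvg0 : tail G x @[x --> +oo] --> (0 : R).
Proof.
have -> : tail G = fine \o ccdf (idR : {RV G >-> R}).
  by apply/funext => x; rewrite /= /ccdf /distribution /pushforward preimage_id law_ray.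
exact/fine_cvg/cvg_ccdfy0.
Qed.

Hypothesis supp : nonneg_supported G.

Lemma nonneg_law_neg : G `]-oo, 0%R[%classic = 0%E.
Proof.
apply: law_off_support; first exact: interval_open.
apply/seteqP; split=> x //= [] /=; rewrite in_itv /= => x0 /supp /=.
by rewrite in_itv /= andbT leNgt x0.
Qed.

Lemma nonneg_law_le t : G `]-oo, t]%classic = G `[0%R, t]%classic.
Proof.
apply/eqP; rewrite eq_le; apply/andP; split; last first.
  by apply: le_measure; rewrite ?inE //; apply: subset_itvr; rewrite bnd_simp.
apply: le_trans (_ : G (`]-oo, 0%R[%classic `|` `[0%R, t]%classic) <= _)%E.
  apply: le_measure; rewrite ?inE //; first exact: measurableU.
  move=> x /=; rewrite !in_itv /=; case: (ltP x 0) => x0 xt; [by left | by right].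
apply: le_trans (measureU2 _ _ _) _ => //; rewrite -[leRHS]add0e; apply: leeD => //.
by rewrite le_eqVlt; apply/orP; left; apply/eqP; exact: nonneg_law_neg.
Qed.

Lemma nonneg_law_ray0 : G `[0%R, +oo[%classic = 1%E.
Proof.
have := probability_setC G (measurable_itv `]-oo, 0%R[).
by rewrite setCitvl nonneg_law_neg sube0.
Qed.

Let Q : probability (measurableTypeR R * measurableTypeR R)%type R := (G \x G)%E.

Let rect (i j : interval R) :
  Q ([set` i] `*` [set` j]) = (G [set` i] * G [set` j])%E.
Proof. by apply: product_measure1E; exact: measurable_itv. Qed.

(** Three disjoint rectangles inside the half-plane where the sum exceeds [x]:
the first variable above [x]; the first variable at most [t] and the second
above [x]; the first variable between [t] and [x] and the second above x - t. *)
Lemma convolution_tail_ge t x : 0 < t -> t <= x ->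
  tail G x + (1 - tail G t) * tail G x + (tail G t - tail G x) * tail G (x - t)
    <= tail (convolution G G) x.
Proof.
move=> t0 tx.
pose add (z : measurableTypeR R * measurableTypeR R) := z.1 + z.2.
have madd : measurable_fun setT add by apply: measurable_funD.
have mA i : measurable (add @^-1` [set` (i : interval R)]).
  by rewrite -[X in measurable X]setTI; apply: madd => //; exact: measurable_itv.
have -> : tail (convolution G G) x = fine (Q (add @^-1` `]x, +oo[)).
  rewrite /tail /convolution /pushforward -/add.
  have -> : add @^-1` `]x, +oo[ = ~` (add @^-1` `]-oo, x]).
    by rewrite preimage_setC setCitvl.
  exact: esym (fine_prob_setC Q (mA _)).
pose R1 := `]x, +oo[%classic `*` `[0, +oo[%classic :
  set (measurableTypeR R * measurableTypeR R).
pose R2 := `[0, t]%classic `*` `]x, +oo[%classic : set (measurableTypeR R * measurableTypeR R).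
pose R3 := `]t, x]%classic `*` `]x - t, +oo[%classic :
  set (measurableTypeR R * measurableTypeR R).
have m1 : measurable R1 by apply: measurableX.
have m2 : measurable R2 by apply: measurableX.
have m3 : measurable R3 by apply: measurableX.
have e1 : Q R1 = (tail G x)%:E.
  by rewrite /R1 rect nonneg_law_ray0 mule1 law_ray.
have e2 : Q R2 = ((1 - tail G t) * tail G x)%:E.
  rewrite /R2 rect -nonneg_law_le law_ray EFinM; congr (_ * _)%E.
  by rewrite /tail opprB addrCA subrr addr0 fineK // law_fin.
have e3 : Q R3 = ((tail G t - tail G x) * tail G (x - t))%:E.
  by rewrite /R3 rect law_itv // law_ray EFinM.
rewrite -lee_fin 2!EFinD -e1 -e2 -e3 fineK; last by rewrite fin_num_measure //; exact: mA.
rewrite -!measureU //.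
- apply: le_measure; rewrite ?inE //; first by apply: measurableU => //; apply: measurableU.
  move=> [y z]; rewrite /R1 /R2 /R3 /add /= !in_itv /= !andbT.
  by case=> [[]|] [] /=; [|move=> /andP[]|move=> /andP[]]; lra.
- exact: measurableU.
- apply/seteqP; split=> // -[y z] /=; rewrite /R1 /R2 /R3 /= !in_itv /= !andbT.
  by case=> [[] [] + _ [+ _]]; [|move=> /andP[_]] => y1 /andP[y2 y3]; lra.
- apply/seteqP; split=> // -[y z] /=; rewrite /R1 /R2 /= !in_itv /= !andbT.
  by case=> -[y1 _] [/andP[_ y2] _]; lra.
Qed.

(** In [convolution_tail_ge] divided by tail x, the right side tends to 2, which
leaves tail (x - t) / tail x with limit superior at most 1. For the cruder
bound 3, still uniform in [t], it is enough to know that limit within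
tail t / 2, and that tail x is at most tail t / 2. *)
Lemma class_S_tail_shift t : (forall x, 0 < tail G x) -> class_S R G -> 0 < t ->
  \forall x \near +oo, tail G (x - t) <= 3 * tail G x.
Proof.
move=> G0 SG t0.
have d0 : 0 < tail G t / 2 by rewrite divr_gt0.
have h1 : \forall x \near +oo, tail (convolution G G) x / tail G x <= 2 + tail G t / 2.
  by near=> x; near: x; apply: (cvgr_le 2 SG); rewrite ltrDl.
have h2 : \forall x \near +oo, tail G x <= tail G t / 2.
  by near=> x; near: x; apply: (cvgr_le 0 tail_cvg0).
near=> x.
have tx : t <= x by near: x; apply: nbhs_pinfty_ge; rewrite num_real.
have a1 : tail (convolution G G) x / tail G x <= 2 + tail G t / 2 by near: x.
have a2 : tail G x <= tail G t / 2 by near: x.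
have := convolution_tail_ge t0 tx; move: a1; rewrite ler_pdivrMr // => a1 a3.
have := G0 x; have := G0 t; have := G0 (x - t).
rewrite -(ler_pM2l d0); nra.
Unshelve. all: by end_near. Qed.

End Subexp.

(** * The dyadic piecewise linear tail *)
Section Seq.
Variable R : realFieldType.

(** [node n] is the value at 2^n of the integrated tail before normalisation,
and [- slope n] its slope on the n-th block; [step] and [chord] are the tail and
the integrated tail at integers. As the logarithm of 0 is 0, the first block is
extended linearly down to 0. *)
Fixpoint node (n : nat) : R := if n is m.+1 then node m / 2 ^+ n else 1.
Definition slope (n : nat) : R := (node n - node n.+1) / 2 ^+ n.
Definition step (m : nat) : R := slope (trunc_log 2 m).
Definition chord (m : nat) : R :=
  let n := trunc_log 2 m in node n - slope n * (m%:R - 2 ^+ n).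

Lemma exp2_gt0 n : 0 < 2 ^+ n :> R.
Proof. by rewrite exprn_gt0. Qed.

Lemma exp2_ge1 n : 1 <= 2 ^+ n :> R.
Proof. by rewrite exprn_ege1 // ler1n. Qed.

Lemma node_gt0 n : 0 < node n.
Proof. by elim: n => //= n IH; rewrite divr_gt0 // exp2_gt0. Qed.

Lemma nodeS n : node n = 2 ^+ n.+1 * node n.+1.
Proof. by rewrite /= mulrC divfK // gt_eqF // exp2_gt0. Qed.

Lemma node_slope n : node n.+1 = node n - slope n * 2 ^+ n.
Proof. by rewrite /slope divfK ?gt_eqF ?exp2_gt0 //; lra. Qed.

Lemma slope_ge n : node n.+1 <= slope n.
Proof.
rewrite /slope ler_pdivlMr ?exp2_gt0 // (nodeS n) exprS.
have := exp2_ge1 n; have := node_gt0 n.+1; nra.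
Qed.

Lemma slope_le n : slope n <= 2 * node n.+1.
Proof.
rewrite /slope ler_pdivrMr ?exp2_gt0 // (nodeS n) exprS.
have := node_gt0 n.+1; nra.
Qed.

Lemma slope_gt0 n : 0 < slope n.
Proof. exact: lt_le_trans (node_gt0 _) (slope_ge n). Qed.

(** The slope on the next block is at most node n.+1 / 2^n.+1, while the slope
on this block is at least node n.+1: the tail jumps down at 2^n.+1. *)
Lemma slope_drop n : 2 ^+ n.+1 * slope n.+1 <= slope n.
Proof.
apply: le_trans (slope_ge n); rewrite /slope mulrC divfK ?gt_eqF ?exp2_gt0 //.
by rewrite gerBl ltW // node_gt0.
Qed.

Lemma slopeS_le n : slope n.+1 <= slope n.
Proof.
apply: le_trans (slope_drop n); rewrite ler_peMl ?exp2_ge1 // ltW //.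
exact: slope_gt0.
Qed.

Lemma slope_nincr m n : (m <= n)%N -> slope n <= slope m.
Proof. exact: (nonincreasing_seqP slope).1 slopeS_le m n. Qed.

Lemma step_gt0 m : 0 < step m. Proof. exact: slope_gt0. Qed.

Lemma step_nincr m n : (m <= n)%N -> step n <= step m.
Proof. by move=> mn; apply/slope_nincr/leq_trunc_log. Qed.

Lemma step0 : step 0 = 2^-1.
Proof. by rewrite /step trunc_log0 /slope /= expr0 expr1; lra. Qed.

Lemma step_le1 m : step m <= 1.
Proof. by apply: le_trans (step_nincr (leq0n m)) _; rewrite step0; lra. Qed.

Lemma chord_block n m : (2 ^ n <= m <= 2 ^ n.+1)%N ->
  chord m = node n - slope n * (m%:R - 2 ^+ n).
Proof.
move=> /andP[nm]; rewrite leq_eqVlt => /predU1P[->|mn].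
  rewrite /chord trunc_expnK // natrX subrr mulr0 subr0 node_slope exprS.
  by ring.
by rewrite /chord (@trunc_log_eq 2 n m) // nm.
Qed.

Lemma chord_exp2 n : chord (2 ^ n) = node n.
Proof. by rewrite /chord trunc_expnK // natrX subrr mulr0 subr0. Qed.

Lemma chord1 : chord 1 = 1. Proof. exact: (chord_exp2 0). Qed.

Lemma chord0 : chord 0 = 3 / 2.
Proof.
by rewrite /chord trunc_log0 /slope /= expr0 expr1 divr1 mulr0n sub0r; lra.
Qed.

Lemma trunc_log2_itv m : (0 < m)%N ->
  (2 ^ trunc_log 2 m <= m < 2 ^ (trunc_log 2 m).+1)%N.
Proof. by move=> m0; rewrite trunc_logP // trunc_log_ltn. Qed.

Lemma chordS m : chord m.+1 = chord m - step m.
Proof.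
have [->|m0] := posnP m.
  by rewrite chord0 step0 chord1; lra.
have /andP[h1 h2] := trunc_log2_itv m0.
rewrite (@chord_block (trunc_log 2 m) m.+1); last by rewrite h2 (leq_trans h1).
by rewrite /chord /step -[m.+1%:R]natr1; lra.
Qed.

Lemma chord_nincr m n : (m <= n)%N -> chord n <= chord m.
Proof.
apply: (nonincreasing_seqP chord).1 m n => k.
by rewrite chordS gerBl ltW // step_gt0.
Qed.

Lemma node_le_chord m : node (trunc_log 2 m).+1 <= chord m.
Proof.
rewrite -chord_exp2; apply: chord_nincr; apply: ltnW; exact: trunc_log_ltn.
Qed.

Lemma chord_gt0 m : 0 < chord m.
Proof. exact: lt_le_trans (node_gt0 _) (node_le_chord m). Qed.

Lemma chord_le_node m : (0 < m)%N -> chord m <= node (trunc_log 2 m).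
Proof. by move=> m0; rewrite -chord_exp2; apply: chord_nincr; apply: trunc_logP. Qed.

(** Within a block, going back by [k] adds [slope n * k], and the slope is at
most 2 * node n.+1, twice the smallest value on the block. *)
Lemma chord_back_block n m k : (2 ^ n + k <= m <= 2 ^ n.+1)%N ->
  chord (m - k) <= (1 + 2 * k%:R) * chord m.
Proof.
move=> /andP[h1 h2]; have km : (k <= m)%N by lia.
rewrite !(@chord_block n) ?natrB //; [|by apply/andP; lia|by apply/andP; lia].
have : node n.+1 <= node n - slope n * (m%:R - 2 ^+ n).
  rewrite node_slope lerD2l lerN2 ler_pM2l ?slope_gt0 //.
  move: h2; rewrite -(ler_nat R) natrX exprS; lra.
have := slope_le n; have := slope_gt0 n; have k0 : 0 <= k%:R :> R by [].
nra.
Qed.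

(** Going back by at most half of [m] crosses at most one node, and each of the
two blocks contributes a factor 1 + 2k at most. *)
Lemma chord_back m k : (2 * k <= m)%N ->
  chord (m - k) <= (1 + 2 * k%:R) ^+ 2 * chord m.
Proof.
move=> km; have [->|m0] := posnP m.
  have -> : (0 - k = 0)%N by [].
  rewrite ler_peMl ?(ltW (chord_gt0 _)) // exprn_ege1 // lerDl mulr_ge0 //.
have /andP[h1 h2] := trunc_log2_itv m0; set n := trunc_log 2 m in h1 h2.
have k1 : 1 <= 1 + 2 * k%:R :> R by rewrite lerDl mulr_ge0.
have p0 := chord_gt0 m.
have [h|h] := leqP (2 ^ n + k)%N m.
  have := @chord_back_block n m k; rewrite h (ltnW h2) => /(_ isT) /le_trans; apply.
  by rewrite ler_pM2r // expr2 ler_peMl // (le_trans ler01).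
case: n h1 h2 h => [|n]; first by rewrite !expn0 expn1 => *; exfalso; lia.
move=> h1 h2 h; pose j := (m - 2 ^ n.+1)%N.
have a1 : chord (2 ^ n.+1) <= (1 + 2 * j%:R) * chord m.
  have -> : (2 ^ n.+1 = m - j)%N by rewrite /j; lia.
  by apply: (@chord_back_block n.+1); apply/andP; rewrite /j; lia.
have a2 : chord (m - k) <= (1 + 2 * (k - j)%N%:R) * chord (2 ^ n.+1).
  have -> : (m - k = 2 ^ n.+1 - (k - j))%N by rewrite /j; lia.
  apply: (@chord_back_block n); move: h1 h; rewrite /j !expnS; lia.
apply: (le_trans a2).
have jk : (j <= k)%N by rewrite /j; lia.
have b1 : 1 + 2 * j%:R <= 1 + 2 * k%:R :> R by rewrite lerD2l ler_pM2l // ler_nat.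
have b2 : 1 + 2 * (k - j)%N%:R <= 1 + 2 * k%:R :> R.
  by rewrite lerD2l ler_pM2l // ler_nat leq_subr.
have b3 : 0 <= (1 + 2 * (k - j)%N%:R) :> R by rewrite addr_ge0 // mulr_ge0.
have b4 : 0 <= (1 + 2 * j%:R) :> R by rewrite addr_ge0 // mulr_ge0.
rewrite expr2 -mulrA; apply: le_trans (ler_wpM2l b3 a1) _.
rewrite ler_pM // ?mulr_ge0 //; first exact: ltW.
by rewrite ler_wpM2r // ltW.
Qed.

Lemma chord_pred m : chord m <= 9 * chord m.+1.
Proof.
have [->|m0] := posnP m.
  by rewrite chord0 chord1; lra.
have := @chord_back m.+1 1 ltac:(lia); rewrite subn1 /=.
by have -> : (1 + 2 * 1%:R) ^+ 2 = 9 :> R by ring.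
Qed.

(** As node n = 2^-(n(n+1)/2), the exponent to bound is (n+1)N - n(n+1)/2; its
part that grows with [n], nN - n(n+1)/2, is at most 2 N^2. *)
Lemma node_exp N : exists C : R, forall n, node n * 2 ^+ (n.+1 * N) <= C.
Proof.
exists (2 ^+ (N + 2 * N ^ 2)) => n.
suff -> : node n = (2 ^+ 'C(n.+1, 2))^-1.
  rewrite mulrC ler_pdivrMr ?exp2_gt0 // -exprD ler_weXn2l ?ler1n //.
  have := mul_bin_diag n.+1 1; rewrite bin1 /=; nia.
elim: n => [|n IH]; first by rewrite bin_small // expr0 invr1.
by rewrite /= IH (binS n.+1) bin1 exprD invfM.
Qed.

Lemma chord_poly N : exists C : R, forall m, chord m * (m.+1)%:R ^+ N <= C.
Proof.
have [C hC] := node_exp N; exists (Num.max C (3/2)) => m.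
have [->|m0] := posnP m; first by rewrite chord0 expr1n mulr1 le_max lexx orbT.
rewrite le_max; apply/orP; left; apply: le_trans (hC (trunc_log 2 m)).
have m1 : (m.+1%:R : R) <= 2 ^+ (trunc_log 2 m).+1.
  by rewrite -natrX ler_nat trunc_log_ltn.
rewrite exprM ler_pM ?chord_le_node ?(ltW (chord_gt0 _)) ?exprn_ge0 //.
by apply: lerXn2r => //; rewrite nnegrE ltW // exp2_gt0.
Qed.

(** The terms are O(1/(k+1)^2) by [chord_poly] with N = 4, and 1/((k+1)(k+2))
telescopes. *)
Lemma chord_quad_sum : exists C : R, 0 < C /\ forall M N,
  \sum_(M <= k < N) (1 + 2 * k%:R) ^+ 2 * chord k <= C / M.+1%:R.
Proof.
have [C hC] := chord_poly 4; exists (Num.max 1 (8 * C)).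
split=> [|M N]; first by rewrite lt_max ltr01.
set D := Num.max _ _; have D0 : 0 < D by rewrite lt_max ltr01.
have [NM|MN] := leqP N M.
  by rewrite big_geq // divr_ge0 // ltW.
suff h k : (1 + 2 * k%:R) ^+ 2 * chord k <= D * (k.+1%:R^-1 - k.+2%:R^-1).
  apply: (le_trans (ler_sum _ (fun k _ => h k))).
  rewrite -mulr_sumr (eq_bigr (fun k => - k.+2%:R^-1 - - k.+1%:R^-1)); last first.
    by move=> k _; rewrite opprK addrC.
  rewrite (telescope_sumr (fun k => - k.+1%:R^-1)) ?(ltnW MN) // opprK.
  by rewrite ler_pM2l // gerDr oppr_le0 invr_ge0.
have -> : k.+1%:R^-1 - k.+2%:R^-1 = (k.+1%:R * k.+2%:R)^-1 :> R.
  rewrite -[k.+2%:R]natr1; have : 0 < k.+1%:R :> R by rewrite ltr0n.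
  move: (k.+1%:R) => x x0; have x1 : 0 < x + 1 by rewrite addr_gt0.
  by field; rewrite (gt_eqF x0) (gt_eqF x1).
have kk : 0 <= k%:R :> R by [].
rewrite ler_pdivlMr ?mulr_gt0 ?ltr0n //.
apply: le_trans (_ : 8 * C <= _); last by rewrite le_max lexx orbT.
apply: le_trans (_ : 8 * (chord k * k.+1%:R ^+ 4) <= _); last by rewrite ler_pM2l.
have p0 := chord_gt0 k.
have -> : (1 + 2 * k%:R) ^+ 2 * chord k * (k.+1%:R * k.+2%:R) =
  chord k * ((1 + 2 * k%:R) ^+ 2 * (k.+1%:R * k.+2%:R)) :> R by ring.
rewrite [X in _ <= X]mulrCA ler_pM2l // -[k.+2%:R]natr1 -[k.+1%:R]natr1.
have : (1 + 2 * k%:R) ^+ 2 <= 4 * (k%:R + 1) ^+ 2 :> R by nra.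
have : (k%:R + 1) * (k%:R + 1 + 1) <= 2 * (k%:R + 1) ^+ 2 :> R by nra.
have : 0 <= (k%:R + 1) * (k%:R + 1 + 1) :> R by nra.
set a := (1 + _) ^+ 2; set b := (k%:R + 1) * (_ + 1).
set c := (k%:R + 1) ^+ 2 => b0 bc ac.
have -> : (k%:R + 1) ^+ 4 = c * c :> R by rewrite /c; ring.
by nra.
Qed.

(** For 2k <= m the factor chord (m - k) is compared with chord m by
[chord_back]; for 2k > m the roles of [k] and m - k are exchanged. This yields
twice the weighted tail sum of [chord]. *)
Lemma chord_conv_small C M m :
  (forall N, \sum_(M <= k < N) (1 + 2 * k%:R) ^+ 2 * chord k <= C) ->
  \sum_(M <= k < (m - M).+1) chord k * chord (m - k) <= 2 * C * chord m.
Proof.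
move=> hC; have p0 k := ltW (chord_gt0 k).
have q0 k : 0 <= (1 + 2 * k%:R) ^+ 2 :> R by rewrite exprn_ge0 // addr_ge0 // mulr_ge0.
have C0 : 0 <= C by apply: le_trans (hC 0%N); rewrite big_geq.
have [mM|Mm] := leqP (m - M).+1 M.
  by rewrite big_geq // !mulr_ge0.
pose W k : R := (1 + 2 * k%:R) ^+ 2 * chord k.
apply: le_trans (_ : \sum_(M <= k < (m - M).+1) (W k + W (m - k)%N) * chord m <= _).
  rewrite !big_nat; apply: ler_sum => k /andP[k1 k2].
  have [h|h] := leqP (2 * k)%N m.
    apply: le_trans (_ : W k * chord m <= _); last first.
      by rewrite ler_wpM2r // lerDl mulr_ge0.
    rewrite /W [_ * chord k]mulrC -mulrA ler_wpM2l //; exact: chord_back.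
  apply: le_trans (_ : W (m - k)%N * chord m <= _); last first.
    by rewrite ler_wpM2r // lerDr mulr_ge0.
  rewrite /W mulrC -[_ * chord m]mulrA [X in _ <= X]mulrCA ler_wpM2l //.
  have {1}-> : k = (m - (m - k))%N by lia.
  by apply: chord_back; lia.
rewrite -mulr_suml ler_wpM2r // big_split /= mulr2n mulrDl mul1r lerD //.
rewrite big_nat_rev /=; apply: le_trans (hC (m - M).+1).
rewrite le_eqVlt big_nat [X in _ == X]big_nat; apply/orP; left; apply/eqP.
by apply: eq_bigr => k /andP[k1 k2]; congr W; lia.
Qed.
End Seq.

(** * The law with a dyadic step tail *)
Section StepLaw.
Variable R : realType.

Lemma chord_cvg0 : chord R n @[n --> \oo] --> (0 : R).
Proof.
have [C hC] := chord_poly R 1.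
apply/cvgrPdist_le => eps e0; near=> n.
rewrite sub0r normrN ger0_norm; last exact/ltW/chord_gt0.
have := hC n; rewrite expr1 -ler_pdivlMr ?ltr0n // => /le_trans; apply.
rewrite ler_pdivrMr ?ltr0n // mulrC -ler_pdivrMr //.
apply: le_trans (_ : n%:R <= _); last by rewrite ler_nat.
by near: n; apply: nbhs_infty_ger.
Unshelve. all: by end_near. Qed.

Lemma step_le_chord m : step R m <= chord R m.
Proof. by have := chordS R m; have := chord_gt0 R m.+1; lra. Qed.

Definition step_cdf (x : R) : R := if x < 0 then 0 else 1 - step R (Num.truncn x).

Let step_cdf_nd : nondecreasing step_cdf.
Proof.
move=> x y xy; rewrite /step_cdf; case: (ltP y 0) => y0.
  by rewrite (le_lt_trans xy y0).
case: (ltP x 0) => x0; first by rewrite subr_ge0 step_le1.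
by rewrite lerD2l lerN2; apply: step_nincr; apply: le_truncn.
Qed.

Let step_cdf_rc : right_continuous step_cdf.
Proof.
move=> x; apply: cvg_near_cst; rewrite /step_cdf.
case: (ltP x 0) => x0; near=> y.
  by have -> : y < 0 by near: y; apply: nbhs_right_lt.
have xy : x < y by near: y; apply: nbhs_right_gt.
have yx : y < (Num.truncn x).+1%:R.
  by near: y; apply: nbhs_right_lt; have /andP[] := truncn_itv x0.
have y0 : 0 <= y by apply: le_trans x0 (ltW xy).
rewrite ltNge y0 /=; congr (_ - step R _).
apply/eqP; rewrite truncn_eq // yx andbT; apply: le_trans (ltW xy).
by rewrite truncn_le.
Unshelve. all: by end_near. Qed.

HB.instance Definition _ := isCumulative.Build R _ R step_cdf step_cdf_nd step_cdf_rc.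

Let step_cdf_Ny : step_cdf x @[x --> -oo] --> (0 : R).
Proof.
apply: cvg_near_cst; near=> x; rewrite /step_cdf.
by have -> : x < 0 by near: x; apply: nbhs_ninfty_lt; rewrite num_real.
Unshelve. all: by end_near. Qed.

Let step_cdf_y : step_cdf x @[x --> +oo] --> (1 : R).
Proof.
apply/cvgrPdist_le => eps e0.
have /cvgrPdist_le/(_ _ e0)[N _ hN] := chord_cvg0.
near=> x; have Nx : N%:R <= x by near: x; apply: nbhs_pinfty_ge; rewrite num_real.
have x0 : 0 <= x by apply: le_trans Nx.
rewrite /step_cdf ltNge x0 /= opprB addrCA subrr addr0 ger0_norm; last exact/ltW/step_gt0.
apply: le_trans (step_le_chord _) _.
have := hN (Num.truncn x); rewrite sub0r normrN ger0_norm; last exact/ltW/chord_gt0.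
by apply; rewrite /= truncn_ge_nat.
Unshelve. all: by end_near. Qed.

HB.instance Definition _ :=
  isCumulativeBounded.Build R 0 1 step_cdf step_cdf_Ny step_cdf_y.

Definition step_law : law R := lebesgue_stieltjes_measure step_cdf.

Lemma tail_step_law x : 0 <= x -> tail step_law x = step R (Num.truncn x).
Proof.
move=> x0; rewrite /tail.
have -> : step_law `]-oo, x]%classic = (step_cdf x)%:E.
  exact: cdf_lebesgue_stieltjes_id.
by rewrite /= /step_cdf ltNge x0 /= opprB addrCA subrr addr0.
Qed.

Lemma tail_step_law_neg x : x < 0 -> tail step_law x = 1.
Proof.
move=> x0; rewrite /tail.
have -> : step_law `]-oo, x]%classic = (step_cdf x)%:E.
  exact: cdf_lebesgue_stieltjes_id.
by rewrite /= /step_cdf x0 subr0.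
Qed.

Lemma tail_step_law_gt0 x : 0 < tail step_law x.
Proof.
have [x0|x0] := ltP x 0; first by rewrite tail_step_law_neg.
by rewrite tail_step_law // step_gt0.
Qed.

Lemma step_law_unbounded_nonneg : unbounded_nonneg step_law.
Proof.
split=> [x xF|].
  rewrite /= in_itv /= andbT leNgt; apply/negP => x0.
  have : (0 < step_law `]-oo, (x / 2)%R[%classic)%E.
    by apply: xF; [exact: interval_open | rewrite /= in_itv /=; lra].
  apply/negP; rewrite -leNgt.
  apply: le_trans (_ : step_law `]-oo, (x / 2)%R]%classic <= _)%E.
    by apply: le_measure; rewrite ?inE //; apply: subset_itvl; rewrite bnd_simp.
  have := @tail_step_law_neg (x / 2) ltac:(lra); rewrite /tail => h.
  by rewrite -[leLHS]fineK ?law_fin // lee_fin; lra.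
move=> [M [_ hM]]; have M1 : M < M + 1 by rewrite ltrDl.
have : step_law `]M + 1, +oo[%classic = 0%E.
  apply: law_off_support; first exact: interval_open.
  apply/seteqP; split=> x //= [] /=; rewrite in_itv /= andbT => Mx /(hM _ M1) /= xM.
  by have := ler_norm x; lra.
by rewrite law_ray => -[] /eqP; rewrite gt_eqF // tail_step_law_gt0.
Qed.

(** The tail is constant between consecutive integers, so that the integral is
the telescoping series of the decrements of [chord]. *)
Lemma integral_tail_step_law k :
  (\int[lebesgue_measure]_(y in `[k%:R, +oo[) (tail step_law y)%:E = (chord R k)%:E)%E.
Proof.
pose I j : set (measurableTypeR R) := `[(k + j)%:R, (k + j).+1%:R[%classic.
have -> : `[k%:R, +oo[%classic = \bigcup_j I j.
  apply/seteqP; split=> [x|x [j _]]; rewrite /I /= !in_itv /= andbT.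
    move=> kx; have x0 : 0 <= x by apply: le_trans kx.
    exists (Num.truncn x - k)%N => //; rewrite /= in_itv /= subnKC.
      exact: truncn_itv.
    by rewrite truncn_ge_nat.
  by move=> /andP[kx _]; apply: le_trans kx; rewrite ler_nat leq_addr.
have mtail (D : set (measurableTypeR R)) : measurable D ->
    measurable_fun D (fun y => (tail step_law y)%:E).
  by move=> mD; apply/measurable_EFinP; exact: measurable_tail.
rewrite ge0_integral_bigcup //=; last 4 first.
- by move=> j; exact: measurable_itv.
- by apply: mtail; apply: bigcupT_measurable => j; exact: measurable_itv.
- by move=> x _; rewrite lee_fin; exact: tail_ge0.
- apply/trivIsetP => i j _ _ ij; apply/seteqP; split=> x //=; rewrite /I /= !in_itv /=.
  move=> [/andP[i1 i2] /andP[j1 j2]]; move/eqP: ij; apply.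
  have := le_lt_trans i1 j2; have := le_lt_trans j1 i2; rewrite !ltr_nat; lia.
have IE j : (\int[lebesgue_measure]_(y in I j) (tail step_law y)%:E = (step R (k + j))%:E)%E.
  rewrite (eq_integral (cst (step R (k + j))%:E)).
    rewrite integral_cst; last exact: measurable_itv.
    rewrite -[RHS]mule1; congr (_ * _)%E.
    have muI : lebesgue_measure (I j) = ((k + j).+1%:R - (k + j)%:R)%:E.
      by rewrite lebesgue_measure_itv /= lte_fin ltr_nat ltnSn EFinB.
    by move: muI; rewrite -natrB // subSnn.
  move=> y; rewrite inE /I /= in_itv /= => jy.
  rewrite tail_step_law; last by apply: le_trans (andP jy).1.
  by congr (step R _)%:E; apply/eqP; rewrite truncn_eq // (le_trans _ (andP jy).1).
under eq_eseriesr do rewrite IE.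
apply: cvg_lim => //.
have -> : (fun n => \sum_(0 <= j < n) (step R (k + j))%:E)%E =
          EFin \o (fun n => chord R k - chord R (k + n)).
  apply/funext => n /=; rewrite sumEFin; congr EFin.
  elim: n => [|n IH]; first by rewrite big_geq // addn0 subrr.
  by rewrite big_nat_recr //= IH addnS chordS; lra.
apply: cvg_EFin; first by near=> n.
rewrite -[X in _ --> X]subr0; apply: cvgB; first exact: cvg_cst.
have -> : (fun n => chord R (k + n)) = (fun n => chord R (n + k)).
  by apply/funext => n; rewrite addnC.
have := chord_cvg0; rewrite -(cvg_shiftn k); exact.
Unshelve. all: by end_near. Qed.

Lemma mean_step_law : mean step_law = (chord R 0)%:E.
Proof. exact: (integral_tail_step_law 0). Qed.


(** Decay faster than every power along the integers is enough, since x^delta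
times the tail stays bounded along them. *)
Lemma not_class_DK1 (F : law R) :
  (forall N, exists C, forall k, tail F k%:R * k.+1%:R ^+ N <= C) -> ~ class_DK1 R F.
Proof.
move=> hF [delta d0 /cvgryPge hd].
pose N := (Num.truncn delta).+1; have [C hC] := hF N.
have [a [_ ha]] := hd (C + 1).
pose k := (Num.truncn `|a|).+1.
have ak : a < k%:R.
  apply: le_lt_trans (ler_norm a) _.
  by have /andP[] := truncn_itv (normr_ge0 a).
have := ha _ ak; apply/negP; rewrite -ltNge ltr_pwDr // mulrC.
apply: le_trans (hC k); rewrite ler_wpM2l ?tail_ge0 //.
have k1 : 1 <= k.+1%:R :> R by rewrite ler1n.
apply: le_trans (_ : k.+1%:R `^ delta <= _).
  by apply: ge0_ler_powR; rewrite ?nnegrE ?ler_nat //; exact: ltW.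
rewrite -powR_mulrn //; apply: ler_powR => //.
by have /andP[_ /ltW] := truncn_itv (ltW d0).
Qed.

(** A cube is used so that, in [step_law_DKc], (n+1)^2 is negligible compared with
2^n. *)
Lemma exp2_cube n : (n.+1 ^ 3 <= 32 * 2 ^ n)%N.
Proof.
case: n => [|[|[|n]]] //; elim: n => // n; rewrite [(2 ^ n.+4)%N]expnS.
by move: (2 ^ n.+3)%N => a; rewrite !expnS !expn0; nia.
Qed.

(** Since 2 <= e and n(n+1)/2 <= n^2. *)
Lemma node_ge n : expR (- n%:R ^+ 2) <= node R n.
Proof.
elim: n => [|n IH]; first by rewrite expr0n oppr0 expR0.
rewrite /= ler_pdivlMr ?exp2_gt0 //; apply: le_trans IH.
have e2 : 2 ^+ n.+1 <= expR (n.+1%:R : R).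
  rewrite -[n.+1%:R]mulr1 expRM_natl lerXn2r ?nnegrE ?expR_ge0 //.
  by have := expR_ge1Dx (1 : R); lra.
apply: le_trans (ler_wpM2l (expR_ge0 _) e2) _; rewrite -expRD ler_expR.
by rewrite -natr1; have : 0 <= n%:R :> R by []; nra.
Qed.

(** On the n-th block the tail is at least exp(-(n+1)^2) while x >= 2^n, so that
(n+1)^2 <= (lambda/2) x eventually and half of the exponential factor
survives. *)
Lemma step_law_DKc : class_DKc R step_law.
Proof.
move=> l l0; apply/cvgryPge => A.
(* 64 / l = 32 / (l / 2), where 32 is the constant of [exp2_cube]. *)
pose n0 := (Num.truncn (64 / l)).+1.
near=> x.
have x1 : 1 <= x by near: x; apply: nbhs_pinfty_ge; rewrite num_real.
have xn : (2 ^ n0)%N%:R <= x by near: x; apply: nbhs_pinfty_ge; rewrite num_real.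
have xA : 2 / l * A <= x by near: x; apply: nbhs_pinfty_ge; rewrite num_real.
have x0 : 0 <= x by apply: le_trans x1.
rewrite tail_step_law // /step; set m := Num.truncn x; set n := trunc_log 2 m.
have mx : m%:R <= x by rewrite truncn_le.
have m0 : (0 < m)%N by rewrite truncn_ge_nat.
have nm : (2 ^ n <= m)%N by apply: trunc_logP.
have n0n : (n0 <= n)%N.
  by rewrite -(@trunc_expnK 2 n0) //; apply: leq_trunc_log; rewrite truncn_ge_nat.
have nl : 64 / l <= n.+1%:R.
  have /andP[_ /ltW h] := truncn_itv (ltW (divr_gt0 (ltr0n R 64) l0)).
  by apply: le_trans h _; rewrite ler_nat; apply: leq_trans n0n _.
have cube : n.+1%:R ^+ 3 <= 32 * x.
  apply: le_trans (_ : (32 * 2 ^ n)%N%:R <= _).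
    by rewrite -natrX ler_nat exp2_cube.
  rewrite natrM ler_pM2l //; apply: le_trans mx; rewrite ler_nat //.
have sq : n.+1%:R ^+ 2 <= l / 2 * x.
  have n1 : 0 < n.+1%:R :> R by rewrite ltr0n.
  move: nl cube; rewrite ler_pdivrMr // exprS => nl cube.
  have : n.+1%:R * n.+1%:R ^+ 2 <= n.+1%:R * (l / 2 * x) by nra.
  by rewrite ler_pM2l.
have : expR (- n.+1%:R ^+ 2) <= slope R n by apply: le_trans (node_ge _) (slope_ge _ _).
move=> /(ler_wpM2l (expR_ge0 (l * x))); apply: le_trans.
rewrite -expRD; apply: le_trans (_ : expR (l / 2 * x) <= _); last first.
  by rewrite ler_expR; lra.
apply: le_trans (expR_ge1Dx _); apply: ler_wpDl => //.
by move: xA; rewrite mulrAC ler_pdivrMr //; lra.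
Unshelve. all: by end_near. Qed.

End StepLaw.

(** * The integrated law *)
Section Final.
Variable R : realType.

Lemma exp2_unbounded (a b : R) :
  exists n, a <= (2 ^ n)%N%:R /\ b <= (2 ^ n)%N%:R.
Proof.
pose c := Num.max a b; exists (Num.truncn `|c|).+1; apply/andP.
rewrite -ge_max -/c; apply: le_trans (ler_norm c) _.
have /andP[_ /ltW h] := truncn_itv (normr_ge0 c); apply: le_trans h _.
by rewrite ler_nat ltnW // ltn_expl.
Qed.

Lemma tail_step_law_nat m : tail (step_law R) m%:R = step R m.
Proof. by rewrite tail_step_law // natrK. Qed.

Lemma step_law_not_OL : ~ class_OL R (step_law R).
Proof.
move=> /(_ 1 ltr01); apply: limsupy_unbounded => B x0.
have [n [Bn xn]] := exp2_unbounded B x0.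
have n1 : (2 ^ n)%N%:R <= (2 ^ n.+1)%N%:R :> R by rewrite ler_nat leq_exp2l.
exists (2 ^ n.+1)%N%:R; first exact: le_trans n1.
have -> : (2 ^ n.+1)%N%:R - 1 = (2 ^ n.+1 - 1)%N%:R :> R by rewrite natrB ?expn_gt0.
rewrite !tail_step_law_nat /step trunc_expnK //.
have -> : trunc_log 2 (2 ^ n.+1 - 1) = n.
  by apply: trunc_log_eq => //; rewrite expnS; have := expn_gt0 2 n; lia.
rewrite ler_pdivlMr ?slope_gt0 //; apply: le_trans (slope_drop R n).
by rewrite -natrX ler_pM2r ?slope_gt0 //; apply: le_trans Bn n1.
Qed.

Lemma step_law_not_DK1 : ~ class_DK1 R (step_law R).
Proof.
apply: not_class_DK1 => N; have [C hC] := chord_poly R N; exists C => k.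
rewrite tail_step_law_nat; apply: le_trans (hC k).
by rewrite ler_wpM2r ?exprn_ge0 //; exact: step_le_chord.
Qed.

Variable FI : law R.
Hypothesis FIE : integrated_tail (step_law R) FI.

Let mu := chord R 0.
Let mu_gt0 : 0 < mu. Proof. exact: chord_gt0. Qed.

Lemma tail_integrated_step_law k : tail FI k%:R = chord R k / mu.
Proof.
rewrite (FIE.2 _ (ler0n _ _)) /Rintegral integral_tail_step_law mean_step_law.
by rewrite mulrC.
Qed.

Lemma integrated_step_law_J : class_J R FI.
Proof.
have mu1 : 1 <= mu by rewrite /mu chord0; lra.
apply: (@class_J_of_tail _ _ _ _ 9) => [||k|eps e0].
- by have := tail_integrated_step_law 0; rewrite divff ?gt_eqF.
- by move=> k; rewrite tail_integrated_step_law divr_gt0 // chord_gt0.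
- by rewrite !tail_integrated_step_law mulrA ler_pM2r ?invr_gt0 //; exact: chord_pred.
have [C [C0 hC]] := chord_quad_sum R.
exists (Num.truncn (2 * C / eps)) => M m hM.
have e1 : 2 * (C / M.+1%:R) <= eps.
  rewrite mulrA ler_pdivrMr ?ltr0n // [X in _ <= X]mulrC -ler_pdivrMr //.
  have /andP[_ /ltW h] := truncn_itv (ltW (divr_gt0 (mulr_gt0 (ltr0n R 2) C0) e0)).
  by apply: le_trans h _; rewrite ler_nat.
have -> : \sum_(M <= k < (m - M).+1) tail FI k%:R * tail FI (m - k)%N%:R =
    (\sum_(M <= k < (m - M).+1) chord R k * chord R (m - k)) / mu / mu.
  rewrite !mulr_suml; apply: eq_bigr => k _.
  by rewrite !tail_integrated_step_law mulf_div invfM mulrA.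
rewrite tail_integrated_step_law mulrA ler_pM2r ?invr_gt0 // ler_pdivrMr //.
have p0 := chord_gt0 R m.
apply: le_trans (chord_conv_small m (hC M)) _.
apply: le_trans (_ : eps * chord R m <= _); first by rewrite ler_pM2r.
by rewrite ler_peMr // mulr_ge0 // ltW.
Qed.

(** The integrated tail at [x] dominates the tail of the original law at x + 1,
up to the mean. *)
Lemma integrated_step_law_DKc : class_DKc R FI.
Proof.
move=> l l0; apply/cvgryPge => A.
have /cvgryPge/(_ (A * expR l * mu))[a [_ ha]] := step_law_DKc l0.
near=> x.
have xa : a < x + 1 by near: x; exists (a - 1); split; [rewrite num_real|move=> y; rewrite ltrBlDr].
have x0 : 0 <= x by near: x; apply: nbhs_pinfty_ge; rewrite num_real.
have /andP[m1 m2] := truncn_itv x0; set m := Num.truncn x in m1 m2.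
have tx : tail (step_law R) (x + 1) / mu <= tail FI x.
  rewrite tail_step_law ?addr_ge0 //.
  have -> : Num.truncn (x + 1) = m.+1.
    apply/eqP; rewrite truncn_eq ?addr_ge0 //; rewrite -!natr1 lerD2r m1 ltrD2r.
    by rewrite natr1.
  apply: le_trans (_ : tail FI m.+1%:R <= _); last exact/tail_nincr/ltW.
  by rewrite tail_integrated_step_law ler_pM2r ?invr_gt0 //; exact: step_le_chord.
apply: le_trans (ler_wpM2l (expR_ge0 _) tx); rewrite mulrA ler_pdivlMr //.
have := ha _ xa; rewrite (_ : l * (x + 1) = l * x + l); last by ring.
by rewrite expRD mulrAC [X in _ <= X -> _]mulrAC ler_pM2r ?expR_gt0.
Unshelve. all: by end_near. Qed.

Lemma integrated_step_law_not_DK1 : ~ class_DK1 R FI.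
Proof.
apply: not_class_DK1 => N; have [C hC] := chord_poly R N; exists (C / mu) => k.
by rewrite tail_integrated_step_law mulrAC ler_pM2r ?invr_gt0.
Qed.

Lemma integrated_step_law_not_D : ~ class_D R FI.
Proof.
apply: limsupy_unbounded => B x0.
have [n [Bn xn]] := exp2_unbounded B x0.
have n1 : (2 ^ n)%N%:R <= (2 ^ n.+1)%N%:R :> R by rewrite ler_nat leq_exp2l.
exists (2 ^ n.+1)%N%:R; first exact: le_trans n1.
have -> : (2 ^ n.+1)%N%:R / 2 = (2 ^ n)%N%:R :> R.
  by rewrite expnS natrM mulrC mulKf.
rewrite !tail_integrated_step_law !chord_exp2 -mulf_div divff ?invr_eq0 ?gt_eqF // mulr1.
rewrite (nodeS R n) mulfK ?gt_eqF ?node_gt0 // -natrX; exact: le_trans n1.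
Qed.

(** Just before 2^n.+1 the slope is at least the value of [chord] at 2^n.+1, so
that each unit step back adds this value at least once. *)
Lemma integrated_step_law_shift (t : nat) x0 : exists2 x, x0 <= x &
  (1 + t%:R) * tail FI x <= tail FI (x - t%:R).
Proof.
have [n [+ xn]] := exp2_unbounded t%:R x0; rewrite ler_nat => tn.
have n1 : (2 ^ n)%N%:R <= (2 ^ n.+1)%N%:R :> R by rewrite ler_nat leq_exp2l.
exists (2 ^ n.+1)%N%:R; first exact: le_trans n1.
have tn1 : (t <= 2 ^ n.+1)%N by rewrite expnS; lia.
rewrite -natrB // !tail_integrated_step_law mulrA ler_pM2r ?invr_gt0 // chord_exp2.
rewrite (@chord_block R n); last by rewrite leq_subr andbT expnS; lia.
rewrite natrB // natrX exprS; have := slope_ge R n; have := node_slope R n.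
have : 0 <= t%:R :> R by []; nra.
Qed.

Lemma integrated_step_law_not_L : ~ class_L R FI.
Proof.
move=> /(_ 1 ltr01) /(cvgr_le 1)/(_ (3 / 2) ltac:(lra)) [a [_ ha]].
have [x ax hx] := integrated_step_law_shift 1 (a + 1).
have := ha x (lt_le_trans _ ax); rewrite ltrDl => /(_ ltr01).
have [k [xk _]] := exp2_unbounded x x.
have F0 : 0 < tail FI x.
  by apply: lt_le_trans (tail_nincr FI xk); rewrite tail_integrated_step_law divr_gt0 // chord_gt0.
by rewrite ler_pdivrMr //; lra.
Qed.

(** If tail FI / tail G lies between [c] and [C], then going back by [t]
multiplies tail FI by at most 3C/c eventually, against 1 + t along a sequence:
a contradiction when t >= 3C/c. *)
Lemma integrated_step_law_not_weakly_S (G : law R) : unbounded_nonneg G -> class_S R G ->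
  ~ weakly_tail_equivalent FI G.
Proof.
move=> [suppG _] SG [/liminfy_gt0[c c0 hc] _ /limsupy_lty[C hC]].
have G0 x : 0 < tail G x.
  rewrite lt_neqAle tail_ge0 andbT; apply/negP => /eqP Gx.
  have [a [_ ha]] := hc; have := ha (Num.max (a + 1) x); rewrite lt_max ltrDl ltr01 => /(_ isT).
  have -> : tail G (Num.max (a + 1) x) = 0.
    by apply/le_anti; rewrite tail_ge0 andbT Gx tail_nincr // le_max lexx orbT.
  by rewrite invr0 mulr0 leNgt c0.
pose t := (Num.truncn `|3 * C / c|).+1.
have t0 : 0 < t%:R :> R by rewrite ltr0n.
have tC : 3 * C / c <= t%:R.
  apply: le_trans (ler_norm _) _; exact: ltW (andP (truncn_itv (normr_ge0 _))).2.
have [[a1 [_ h1]] [a2 [_ h2]] [a3 [_ h3]]] := And3 hc hC (class_S_tail_shift suppG G0 SG t0).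
have [x ax hx] := integrated_step_law_shift t (Num.max a1 (Num.max (a2 + t%:R) a3) + 1).
have {ax} ax : Num.max a1 (Num.max (a2 + t%:R) a3) < x.
  by apply: lt_le_trans ax; rewrite ltrDl.
move: ax; rewrite !gt_max => /and3P[x1 x2 x3].
have := h1 x x1; rewrite ler_pdivlMr // => e1.
have := h2 (x - t%:R); rewrite ltrBrDr => /(_ x2); rewrite ler_pdivrMr // => e2.
have e3 := h3 x x3.
have Fx : 0 < tail FI x by apply: lt_le_trans e1; rewrite mulr_gt0.
have C0 : 0 < C.
  rewrite -(pmulr_lgt0 _ (G0 (x - t%:R))); apply: lt_le_trans e2.
  by apply: lt_le_trans hx; rewrite mulr_gt0 // addr_gt0.
move: tC; rewrite ler_pdivrMr // => tC.
have := G0 x; have a : C * tail G (x - t%:R) <= C * (3 * tail G x) by rewrite ler_pM2l.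
have b : (1 + t%:R) * (c * tail G x) <= (1 + t%:R) * tail FI x.
  by rewrite ler_pM2l // addr_gt0.
nra.
Qed.

End Final.

Theorem proposition1p1 (R : realType) :
  exists F FI : law R,
    [/\ unbounded_nonneg F,
        (0 < mean F < +oo)%E &
        integrated_tail F FI] /\
    [/\ (class_DKc R `\` class_OL R) F,
        ~ class_DK1 R F &
        ~ class_J R F] /\
    [/\ ((class_J R `&` class_DKc R) `\` (class_L R `|` class_D R)) FI,
        ~ class_DK1 R FI &
        forall G : law R, unbounded_nonneg G -> class_S R G ->
          ~ weakly_tail_equivalent FI G].
Proof.
have mE : (0 < mean (step_law R) < +oo)%E.
  by rewrite mean_step_law lte_fin chord_gt0 ltry.
have [FI hFI] := integrated_tail_ex mE.
exists (step_law R), FI; split; [|split]; split=> //.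
- exact: step_law_unbounded_nonneg.
- by split; [exact: step_law_DKc | exact: step_law_not_OL].
- exact: step_law_not_DK1.
- by move=> /(class_J_OL (@tail_step_law_gt0 R)); exact: step_law_not_OL.
- split; first by split; [exact: integrated_step_law_J | exact: integrated_step_law_DKc].
  by case; [exact: integrated_step_law_not_L | exact: integrated_step_law_not_D].
- exact: integrated_step_law_not_DK1.
- by move=> G; exact: integrated_step_law_not_weakly_S.
Qed.
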